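(* There is a deterministic polynomial-time algorithm that, given a hedgegraph $G=(V,E)$ with $n=|V|$, computes an $O(\log n)$-approximation of the connectivity $\lambda$ of $G$.
   Context: A hedgegraph $G=(V,E)$ consists of a finite vertex set $V$ and a finite set $E$ of hedges; each hedge is a set of hyperedges (subsets of $V$), the hyperedges within one hedge are pairwise vertex-disjoint, and no hyperedge belongs to two hedges; the input size is $\sum_{e\in E}\sum_{h\in e}|h|$. For $S\subseteq V$, $\delta(S)$ is the set of hedges containing a hyperedge $h$ with $h\cap S\ne\emptyset$ and $h\setminus S\ne\emptyset$; the connectivity is $\lambda=\min\{|\delta(S)|:\emptyset\ne S\subsetneq V\}$. *)

(* Defs.v *)
From mathcomp Require Import all_boot.

Set Implicit Arguments.
Unset Strict Implicit.
Unset Printing Implicit Defensive.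

(** * Hedgegraphs *)

Section Hedgegraph.
Variable V : finType.

(* [trivIset P] says that distinct members of [P] are disjoint.  Applied to a
   hedge, it says that its hyperedges are vertex-disjoint; applied to the set of
   hedges (sets of hyperedges), that no hyperedge belongs to two hedges. *)
Record hedgegraph := Hedgegraph {
  hedges : {set {set {set V}}};
  hyperedges_disjoint : forall e, e \in hedges -> trivIset e;
  hedges_disjoint : trivIset hedges }.

Definition hedge_cut (G : hedgegraph) (S : {set V}) : {set {set {set V}}} :=
  [set e in hedges G |
    [exists h in e, (h :&: S != set0) && (h :\: S != set0)]].

(* The default value [#|hedges G|] bounds every [#|hedge_cut G S|], so it does
   not affect the minimum as soon as there is a nonempty proper [S], that is,
   when [1 < #|V|]. *)
Definition connectivity (G : hedgegraph) : nat :=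
  \big[minn/#|hedges G|]_(S : {set V} | (S != set0) && (S \proper [set: V]))
    #|hedge_cut G S|.

Definition input_size (G : hedgegraph) : nat :=
  \sum_(e in hedges G) \sum_(h in e) #|h|.

Definition set_of_hedge (e : seq (seq V)) : {set {set V}} :=
  [set:: [seq [set:: h] | h <- e]].

(* [l] lists, without repetition and in an arbitrary order, the hedges of [G],
   the hyperedges of each hedge, and the vertices of each hyperedge. *)
Definition lists (G : hedgegraph) (l : seq (seq (seq V))) : Prop :=
  [/\ hedges G = [set:: map set_of_hedge l],
      uniq (map set_of_hedge l),
      forall e, e \in l -> uniq [seq [set:: h] | h <- e]
    & forall e h, e \in l -> h \in e -> uniq h].

(* Every list is preceded by its length and every vertex is replaced by its
   number in a numbering [nu] of [V]. *)
Definition encode_hyperedge (nu : V -> 'I_#|V|) (h : seq V) : seq nat :=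
  size h :: [seq val (nu v) | v <- h].

Definition encode_hedge (nu : V -> 'I_#|V|) (e : seq (seq V)) : seq nat :=
  size e :: flatten [seq encode_hyperedge nu h | h <- e].

Definition encode (nu : V -> 'I_#|V|) (l : seq (seq (seq V))) : seq nat :=
  #|V| :: size l :: flatten [seq encode_hedge nu e | e <- l].

End Hedgegraph.

(** * Random-access machines *)

(* Programs are those of a unit-cost random-access machine in structured form.
   The memory consists of arrays of natural numbers with computed indices; array
   names are literals, so a program uses only finitely many of them.  The only
   arithmetic is addition and truncated subtraction: without multiplication, [t]
   steps lengthen the binary representation of the numbers in memory by O(t)
   bits only, and unit-cost time is polynomially related to Turing machine
   time. *)

Definition memory := nat -> nat -> nat.

Inductive expr :=
| Const of nat
| Read of nat & expr
| Add of expr & expr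
| Sub of expr & expr.

Inductive program :=
| Skip
| Write of nat & expr & expr
| Seq of program & program
| If of expr & program & program
| While of expr & program.

Fixpoint eval (s : memory) (x : expr) : nat :=
  match x with
  | Const c => c
  | Read a i => s a (eval s i)
  | Add x1 x2 => eval s x1 + eval s x2
  | Sub x1 x2 => eval s x1 - eval s x2
  end.

Fixpoint cost (x : expr) : nat :=
  match x with
  | Const _ => 1
  | Read _ i => (cost i).+1
  | Add x1 x2 | Sub x1 x2 => (cost x1 + cost x2).+1
  end.

Definition update (s : memory) (a i v : nat) : memory :=
  fun b j => if (b == a) && (j == i) then v else s b j.

(* [exec p s t s']: from memory [s], program [p] halts after [t] steps with
   memory [s']. *)
Inductive exec : program -> memory -> nat -> memory -> Prop :=
| exec_skip s : exec Skip s 1 s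
| exec_write a i x s :
    exec (Write a i x) s (cost i + cost x).+1
      (update s a (eval s i) (eval s x))
| exec_seq p q s1 t1 s2 t2 s3 :
    exec p s1 t1 s2 -> exec q s2 t2 s3 -> exec (Seq p q) s1 (t1 + t2) s3
| exec_if x p q s t s' :
    exec (if eval s x != 0 then p else q) s t s' ->
    exec (If x p q) s (cost x + t).+1 s'
| exec_while_stop x p s :
    eval s x = 0 -> exec (While x p) s (cost x).+1 s
| exec_while_loop x p s1 t1 s2 t2 s3 :
    eval s1 x != 0 -> exec p s1 t1 s2 -> exec (While x p) s2 t2 s3 ->
    exec (While x p) s1 (cost x + t1 + t2).+1 s3.

Lemma exec_deterministic p s t1 s1 t2 s2 :
  exec p s t1 s1 -> exec p s t2 s2 -> t1 = t2 /\ s1 = s2.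
Proof.
move=> E; elim: E t2 s2 => {p s t1 s1}; intros; subst;
  match goal with
  | E : exec Skip _ _ _ |- _ => inversion E
  | E : exec (Write _ _ _) _ _ _ |- _ => inversion E
  | E : exec (Seq _ _) _ _ _ |- _ => inversion E
  | E : exec (If _ _ _) _ _ _ |- _ => inversion E
  | E : exec (While _ _) _ _ _ |- _ => inversion E
  end; subst;
  repeat match goal with
  | IH : forall _ _, exec ?p ?s _ _ -> _, E : exec ?p ?s _ _ |- _ =>
      case: (IH _ _ E) => ? ?; subst; clear E
  end; try by [].
all: by match goal with
  | x0 : eval ?s ?x = 0, xN0 : is_true (eval ?s ?x != 0) |- _ =>
      rewrite x0 in xN0
  end.
Qed.

(* The input word fills the first cells of array 0; every other cell is 0. *)
Definition load (w : seq nat) : memory :=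
  fun a i => if a == 0 then nth 0 w i else 0.

(* The output is read in cell 0 of array 1. *)
Definition computes_in (p : program) (w : seq nat) (t out : nat) : Prop :=
  exists2 s, exec p (load w) t s & s 1 0 = out.

(* Main.v *)
Require Import Defs.
From mathcomp Require Import all_boot all_order all_algebra.
From mathcomp Require Import reals exp.
From mathcomp Require Import Rstruct zify ring lra.

(* The connectivity [lam] is approximated by a fractional packing of spanning
   sets of hedges, computed with multiplicative weights.  In each of [X ^ 2]
   rounds, a spanning set is built greedily: the next hedge [j] minimizes
   [2 ^ k j / f j], where [k j] counts the previous uses of [j] and [f j] is the
   number of components that adding [j] would remove.

   If [c] is the largest number of uses of a hedge, then [X ^ 2 <= lam * c],
   because a spanning set meets every cut.  Conversely, each of the [m]
   components is left by at least [lam] hedges, and a hedge that leaves [r]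
   components removes at least [r / 2] of them, so the [f j] sum to at least
   [lam * m / 2].  Hence a greedy step that decreases the number of components
   from [m] to [m'] multiplies the total weight by at most
   [1 + (2 / lam) (m - m') / m], and a round increases its logarithm by at most
   [(2 / lam) ln n].  As the total weight is at least [2 ^ c], this gives
   [lam * c <= X ^ 2 * (1 + 2 L)] when [n <= 2 ^ L].  The output is
   [X ^ 2 * (1 + 2 L) / c], rounded down. *)

Set Implicit Arguments.
Unset Strict Implicit.
Unset Printing Implicit Defensive.

(** * For-programs *)

(* The body of [BFor c p] is run [s lim 0] times, with cell 0 of array [c]
   counting up from 0.  As [lim] may not be written in the body, the program and
   [s lim 0] alone bound the running time. *)
Inductive bprog :=
| BSkip
| BWrite of nat & expr & expr
| BSeq of bprog & bprog
| BIf of expr & bprog & bprog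
| BFor of nat & bprog.

Local Notation lim := 10 (only parsing).

Fixpoint compile (p : bprog) : program :=
  match p with
  | BSkip => Skip
  | BWrite a i x => Write a i x
  | BSeq p q => Seq (compile p) (compile q)
  | BIf x p q => If x (compile p) (compile q)
  | BFor c p =>
      Seq (Write c (Const 0) (Const 0))
        (While (Defs.Sub (Read lim (Const 0)) (Read c (Const 0)))
          (Seq (compile p)
            (Write c (Const 0) (Add (Read c (Const 0)) (Const 1)))))
  end.

Fixpoint sem (p : bprog) (s : memory) : memory :=
  match p with
  | BSkip => s
  | BWrite a i x => update s a (eval s i) (eval s x)
  | BSeq p q => sem q (sem p s)
  | BIf x p q => if eval s x != 0 then sem p s else sem q s
  | BFor c p =>
      update (iteri (s lim 0) (fun k s' => sem p (update s' c 0 k)) s)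
        c 0 (s lim 0)
  end.

Fixpoint writes (p : bprog) : seq nat :=
  match p with
  | BSkip => [::]
  | BWrite a _ _ => [:: a]
  | BSeq p q | BIf _ p q => writes p ++ writes q
  | BFor c p => c :: writes p
  end.

Fixpoint wf (p : bprog) : bool :=
  match p with
  | BSkip | BWrite _ _ _ => true
  | BSeq p q | BIf _ p q => wf p && wf q
  | BFor c p => [&& c != lim, lim \notin writes p, c \notin writes p & wf p]
  end.

(** An upper bound, not the exact time: both branches of a conditional are counted, and [X] is the
    trip count of every loop. In the loop case, 9 is 3 for resetting the counter plus 6 for the
    failing test, and 12 is 6 for a successful test plus 6 for the increment. *)
Fixpoint time (X : nat) (p : bprog) : nat :=
  match p with
  | BSkip => 1
  | BWrite _ i x => (cost i + cost x).+1
  | BSeq p q => time X p + time X q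
  | BIf x p q => (cost x + (time X p + time X q)).+1
  | BFor c p => 9 + X * (time X p + 12)
  end.

Lemma update_other s a i v b : b != a -> update s a i v b = s b.
Proof. by move=> /negPf ab; rewrite /update ab. Qed.

Lemma update_same s a i v : update s a i v a i = v.
Proof. by rewrite /update !eqxx. Qed.

Lemma update_cell s a i v j : j != i -> update s a i v a j = s a j.
Proof. by move=> /negPf ij; rewrite /update ij andbF. Qed.

Lemma sem_frame p s a : a \notin writes p -> sem p s a = s a.
Proof.
elim: p s => [|b i x|p IHp q IHq|x p IHp q IHq|c p IHp] s //=.
- by rewrite inE => ab; apply: update_other.
- by rewrite mem_cat negb_or => /andP[ap aq]; rewrite IHq ?IHp.
- by rewrite mem_cat negb_or => /andP[ap aq]; case: ifP; rewrite ?IHq ?IHp.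
- rewrite inE negb_or => /andP[ac ap]; rewrite update_other //.
  by elim: (s lim 0) => //= k IHk; rewrite IHp // update_other.
Qed.

(** Loop rule. The invariant speaks of the memory just before the counter is set, so the final write
    of the counter is left to the conclusion. *)
Lemma sem_For_ind (I : nat -> memory -> Prop) c p s :
  I 0 s ->
  (forall k s', k < s lim 0 ->
     (forall a, a \notin writes (BFor c p) -> s' a = s a) ->
     I k s' -> I k.+1 (sem p (update s' c 0 k))) ->
  exists2 s', I (s lim 0) s' & sem (BFor c p) s = update s' c 0 (s lim 0).
Proof.
move=> I0 IS /=; set f := fun k s' => sem p (update s' c 0 k).
suff H k : k <= s lim 0 -> I k (iteri k f s) /\
    (forall a, a \notin writes (BFor c p) -> iteri k f s a = s a).
  by exists (iteri (s lim 0) f s) => //; case: (H (s lim 0)).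
elim: k => [//|k IHk] kX /=; have [Ik Fk] := IHk (ltnW kX).
split=> [|a an]; first exact: IS.
move: (an) => /=; rewrite inE negb_or => /andP[ac ap].
by rewrite /f sem_frame // update_other // Fk.
Qed.

Lemma exec_sem X p s : wf p -> s lim 0 = X -> lim \notin writes p ->
  exists2 t, exec (compile p) s t (sem p s) & t <= time X p.
Proof.
elim: p s => [|a i x|p IHp q IHq|x p IHp q IHq|c p IHp] s /=.
- by exists 1 => //; constructor.
- by exists (cost i + cost x).+1 => //; constructor.
- move=> /andP[wp wq] sX; rewrite mem_cat negb_or => /andP[Xp Xq].
  have [t1 E1 T1] := IHp s wp sX Xp.
  have [|t2 E2 T2] := IHq (sem p s) wq _ Xq; first by rewrite sem_frame.
  by exists (t1 + t2); [apply: exec_seq E1 E2 | rewrite leq_add].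
- move=> /andP[wp wq] sX; rewrite mem_cat negb_or => /andP[Xp Xq].
  have [t1 E1 T1] := IHp s wp sX Xp; have [t2 E2 T2] := IHq s wq sX Xq.
  case: ifP => sx.
    exists (cost x + t1).+1; first by apply: exec_if; rewrite sx.
    by lia.
  exists (cost x + t2).+1; first by apply: exec_if; rewrite sx.
  by lia.
- move=> /and4P[cX Xp cp wp] sX _; rewrite sX.
  set f := fun k s' => sem p (update s' c 0 k).
  set b := Seq (compile p) _; set g := Defs.Sub _ _.
  have inv k : iteri k f s lim = s lim.
    elim: k => //= k IHk; rewrite /f sem_frame // update_other //.
    by rewrite eq_sym.
  have lim_c s' v : update s' c 0 v lim = s' lim.
    by rewrite update_other // eq_sym.
  (* Induction on the number [d] of remaining iterations, which is also the value of the guard, as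
     the body writes neither [lim] nor the counter. *)
  suff H d k : k + d = X -> exists2 t,
      exec (While g b) (update (iteri k f s) c 0 k) t
        (update (iteri X f s) c 0 X) & t <= 6 + d * (time X p + 12).
    have [t E T] := H X 0 (add0n X).
    exists (3 + t); last by lia.
    by apply: exec_seq E; apply: exec_write.
  elim: d k => [|d IHd] k.
    rewrite addn0 => ->; exists (cost g).+1 => //; apply: exec_while_stop.
    by rewrite /= lim_c inv sX update_same subnn.
  move=> kX; have [|t E T] := IHd k.+1; first by rewrite addSnnS.
  have [|t1 E1 T1] := IHp (update (iteri k f s) c 0 k) wp _ Xp.
    by rewrite lim_c inv.
  exists (cost g + (t1 + 6) + t).+1; last by move: T T1 => /=; lia.
  apply: exec_while_loop E.
    by rewrite /= lim_c inv sX update_same; lia.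
  apply: exec_seq E1 _.
  have := exec_write c (Const 0) (Add (Read c (Const 0)) (Const 1))
    (sem p (update (iteri k f s) c 0 k)).
  by rewrite /= sem_frame // update_same (addn1 k).
Qed.

(** A loop raises the exponent by one; in compositions the two exponents are added, which dominates
    both. *)
Lemma time_poly p : exists K d, forall X, time X p <= K * X.+1 ^ d.
Proof.
elim: p => [|a i x|p [K1 [d1 H1]] q [K2 [d2 H2]]
  |x p [K1 [d1 H1]] q [K2 [d2 H2]]|c p [K1 [d1 H1]]] /=.
- by exists 1, 0 => X; rewrite muln1.
- by exists (cost i + cost x).+1, 0 => X; rewrite muln1.
- exists (K1 + K2), (d1 + d2) => X; rewrite mulnDl leq_add //.
    by apply: leq_trans (H1 X) _; rewrite leq_mul2l leq_pexp2l ?orbT ?leq_addr.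
  by apply: leq_trans (H2 X) _; rewrite leq_mul2l leq_pexp2l ?orbT ?leq_addl.
- exists ((cost x).+1 + (K1 + K2)), (d1 + d2) => X.
  rewrite mulnDl -addSn leq_add ?leq_pmulr ?expn_gt0 // mulnDl leq_add //.
    by apply: leq_trans (H1 X) _; rewrite leq_mul2l leq_pexp2l ?orbT ?leq_addr.
  by apply: leq_trans (H2 X) _; rewrite leq_mul2l leq_pexp2l ?orbT ?leq_addl.
- exists (9 + K1 + 12), d1.+1 => X; rewrite expnS.
  have e0 : 0 < X.+1 ^ d1 by rewrite expn_gt0.
  have := H1 X; set e := X.+1 ^ d1 in e0 *; nia.
Qed.

(** * Merging components *)

(** Union in quick-find style: the whole class of [a] takes the label of [b], which keeps labels
    idempotent. *)
Definition merge_labels (c : nat -> nat) (a b : nat) : nat -> nat :=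
  fun u => if c u == c a then c b else c u.

(** A triple [(j, a, b)] is an edge between the vertices [a] and [b], contributed by hedge [j]. *)
Definition merge_step j (c : nat -> nat) (e : nat * nat * nat) :=
  if e.1.1 == j then merge_labels c e.1.2 e.2 else c.

Definition merge_hedge (es : seq (nat * nat * nat)) j (c : nat -> nat) :=
  foldl (merge_step j) c es.

(* Labels are idempotent maps, so their fixed points represent the components. *)
Definition nroots n (c : nat -> nat) : nat :=
  count (fun v => c v == v) (iota 0 n).

Definition cuts (es : seq (nat * nat * nat)) (S : pred nat) j : bool :=
  has (fun e => (e.1.1 == j) && (S e.1.2 != S e.2)) es.

Definition cut_size M es S : nat := \sum_(j < M) cuts es S j.

Definition nontrivial n (S : pred nat) : Prop :=
  exists u v, [/\ u < n, v < n, S u & ~~ S v].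

Definition labelling n (c : nat -> nat) : Prop :=
  forall u, u < n -> c u < n /\ c (c u) = c u.

Definition respects n (S : pred nat) (c : nat -> nat) : Prop :=
  forall u v, u < n -> v < n -> c u = c v -> S u = S v.

Definition edges_in n M (es : seq (nat * nat * nat)) : Prop :=
  forall e, e \in es -> [/\ e.1.1 < M, e.1.2 < n & e.2 < n].

Lemma labelling_merge n c a b : a < n -> b < n ->
  labelling n c -> labelling n (merge_labels c a b).
Proof.
move=> an bn cok u un; have [cu ccu] := cok u un.
have [cb ccb] := cok b bn.
rewrite /merge_labels; case: (eqVneq (c u) (c a)) => [|ne].
  by rewrite ccb; case: ifP.
by rewrite ccu (negPf ne).
Qed.

Lemma merge_coarser c a b u v :
  c u = c v -> merge_labels c a b u = merge_labels c a b v.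
Proof. by rewrite /merge_labels => ->. Qed.

Lemma merge_label n c a b u : u < n -> b < n ->
  exists2 v, v < n & merge_labels c a b u = c v.
Proof.
by move=> un bn; rewrite /merge_labels; case: ifP; [exists b | exists u].
Qed.

Lemma merge_ends c a b : merge_labels c a b a = merge_labels c a b b.
Proof. by rewrite /merge_labels eqxx; case: ifP. Qed.

Lemma respects_merge n S c a b : a < n -> b < n -> S a = S b ->
  respects n S c -> respects n S (merge_labels c a b).
Proof.
move=> an bn Sab Sc u v un vn; rewrite /merge_labels.
case: eqP => ua; case: eqP => va e.
- by apply: Sc => //; rewrite ua.
- by rewrite (Sc u a) // Sab; apply: Sc.
- by rewrite (Sc v a) // Sab; apply: Sc.
- exact: Sc.
Qed.

Section Hedges.
Variables (n M : nat) (es : seq (nat * nat * nat)).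
Hypothesis es_in : edges_in n M es.

Lemma merge_hedge_ind (P : (nat -> nat) -> Prop) j c :
  (forall c a b, (j, a, b) \in es -> a < n -> b < n ->
    P c -> P (merge_labels c a b)) ->
  P c -> P (merge_hedge es j c).
Proof.
rewrite /merge_hedge => PS.
suff H es' : {subset es' <= es} -> forall c, P c ->
  P (foldl (merge_step j) c es') by exact: H.
elim: es' => [|[[i a] b] es' IH] sub {}c Pc //=; apply: IH.
  by move=> e ee; apply: sub; rewrite inE ee orbT.
rewrite /merge_step /=; case: eqP => // ij; rewrite ij in sub.
have ab : (j, a, b) \in es by apply: sub; rewrite inE eqxx.
by have [_ an bn] := es_in ab; apply: PS.
Qed.

Lemma labelling_merge_hedge j c :
  labelling n c -> labelling n (merge_hedge es j c).
Proof. by apply: merge_hedge_ind => {}c a b _; apply: labelling_merge. Qed.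

Lemma merge_hedge_coarser j c u v :
  c u = c v -> merge_hedge es j c u = merge_hedge es j c v.
Proof.
move=> cuv; apply: (merge_hedge_ind (P := fun c => c u = c v)) => //.
by move=> {cuv}c a b _ _ _; apply: merge_coarser.
Qed.

Lemma merge_hedge_label j c u : u < n ->
  exists2 v, v < n & merge_hedge es j c u = c v.
Proof.
move=> un.
apply: (merge_hedge_ind (P := fun c' =>
  forall u, u < n -> exists2 v, v < n & c' u = c v)) un => [|w wn].
  move=> c' a b _ an bn H {}u un; have [v vn ->] := merge_label c' a un bn.
  exact: H.
by exists w.
Qed.

Lemma respects_merge_hedge S j c : ~~ cuts es S j ->
  respects n S c -> respects n S (merge_hedge es j c).
Proof.
move=> /hasPn noS; apply: merge_hedge_ind => {}c a b ab an bn.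
apply: respects_merge => //; have := noS _ ab.
by rewrite /= eqxx negbK => /eqP.
Qed.

(** The ends agree once their edge has been processed, and later unions only coarsen the
    labelling. *)
Lemma merge_hedge_ends j c a b : (j, a, b) \in es ->
  merge_hedge es j c a = merge_hedge es j c b.
Proof.
rewrite /merge_hedge; elim: es c => //= e es' IH c; rewrite inE.
case/orP => [/eqP <-|]; last exact: IH.
rewrite /merge_step /= eqxx; move: (merge_ends c a b); set c' := merge_labels c a b.
elim: es' c' {IH} => //= -[[i a'] b'] es' IH c' e'; apply: IH.
by rewrite /merge_step /=; case: ifP => _ //; apply: merge_coarser.
Qed.

(** Merging hands out only labels already in use, and these are roots by idempotence. *)
Lemma nroots_merge_hedge j c : labelling n c ->
  {subset [pred v | (v < n) && (merge_hedge es j c v == v)]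
    <= [pred v | (v < n) && (c v == v)]}.
Proof.
move=> cok v; rewrite !inE => /andP[vn /eqP v'].
have [u un] := merge_hedge_label j c vn; rewrite v' vn => -> /=.
by have [_ ->] := cok u un.
Qed.

(** Some edge of the hedge has exactly one end in the class of [x]; the label of its other end is
    the required [y]. *)
Lemma cuts_class j c x : labelling n c -> x < n -> c x = x ->
  cuts es (fun u => c u == x) j ->
  exists y, [/\ y < n, c y = y, y != x &
    merge_hedge es j c y = merge_hedge es j c x].
Proof.
move=> cok xn cx /hasP[[[i a] b] ab] /= /andP[/eqP ij]; rewrite {i}ij in ab.
have [_ /= an bn] := es_in ab.
have cE u : u < n -> merge_hedge es j c (c u) = merge_hedge es j c u.
  by move=> un; apply: merge_hedge_coarser; have [] := cok u un.
have := merge_hedge_ends c ab.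
have [an' ca] := cok a an; have [bn' cb] := cok b bn.
case: (eqVneq (c a) x) => ax; case: (eqVneq (c b) x) => bx e _ //.
  by exists (c b); split=> //; rewrite cE // -e -[in RHS]ax cE.
by exists (c a); split=> //; rewrite cE // e -[in RHS]bx cE.
Qed.

(* A component touched by a hedge either stops being a root, or stays one and
   absorbs another root; hence at most two touched components per lost root. *)
Lemma touched_roots j c : labelling n c ->
  count (fun x => (c x == x) && cuts es (fun u => c u == x) j) (iota 0 n)
    <= 2 * (nroots n c - nroots n (merge_hedge es j c)).
Proof.
move=> cok; set c' := merge_hedge es j c.
pose lost := [seq v <- iota 0 n | (c v == v) && (c' v != v)].
have lostE : size lost = nroots n c - nroots n c'.
  rewrite size_filter /nroots.
  have -> : count (fun v => c v == v) (iota 0 n) =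
      count (fun v => (c v == v) && (c' v != v)) (iota 0 n) +
      count (fun v => c' v == v) (iota 0 n).
    rewrite -size_filter -(count_predC (fun v => c' v == v)) addnC.
    rewrite !count_filter; congr (_ + _).
      by apply: eq_count => v /=; rewrite andbC.
    apply: eq_in_count => v; rewrite mem_iota /= add0n => vn.
    case c'v: (c' v == v) => //=.
    have := nroots_merge_hedge (j := j) cok (x := v).
    by rewrite !inE vn -/c' c'v /= => /(_ isT) ->.
  by rewrite addnK.
(* Every touched root occurs in [lost ++ map c' lost]: a surviving root [x] is the new label of the
   lost root [y] that it absorbs. *)
rewrite -lostE mul2n -addnn -[X in _ <= _ + X](size_map c') -size_cat.
rewrite -size_filter; apply: uniq_leq_size.
  by rewrite filter_uniq ?iota_uniq.
move=> x; rewrite mem_filter mem_iota /= add0n => /andP[/andP[/eqP cx cut] xn].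
rewrite mem_cat mem_filter mem_iota cx eqxx add0n xn /= andbT.
case: eqVneq => //= c'x.
have [y [yn cy yx yE]] := cuts_class cok xn cx cut.
apply/mapP; exists y; last by rewrite -/c' in yE; rewrite yE.
by rewrite mem_filter mem_iota cy eqxx yn -/c' in yE *; rewrite yE c'x eq_sym yx.
Qed.

Lemma nroots_gt1 c x : labelling n c -> x < n -> c x = x -> 1 < nroots n c ->
  exists2 y, y < n & c y = y /\ y != x.
Proof.
move=> cok xn cx; rewrite /nroots -size_filter.
set s := filter _ _ => s1.
have us : uniq s by rewrite filter_uniq ?iota_uniq.
have [/hasP[y]|/hasPn H] := boolP (has (fun y => y != x) s).
  rewrite mem_filter mem_iota add0n => /andP[/eqP cy yn] yx.
  by exists y.
have : size s <= size [:: x].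
  by apply: uniq_leq_size => // y /H; rewrite negbK inE.
by rewrite leqNgt s1.
Qed.

(** Double counting of the pairs of a root and a hedge crossing its class. A class is a nontrivial
    set because a second root exists, so at least [lam] hedges cross it; [touched_roots] bounds the
    pairs of each hedge. *)
Lemma sum_drop lam c : labelling n c -> 1 < nroots n c ->
  (forall S, nontrivial n S -> lam <= cut_size M es S) ->
  lam * nroots n c <= 2 * \sum_(j < M) (nroots n c - nroots n (merge_hedge es j c)).
Proof.
move=> cok m1 Hlam.
apply: (@leq_trans (\sum_(j < M) count
    (fun x => (c x == x) && cuts es (fun u => c u == x) j) (iota 0 n)));
  last first.
  by rewrite big_distrr /=; apply: leq_sum => j _; apply: touched_roots.
have -> : \sum_(j < M) count
    (fun x => (c x == x) && cuts es (fun u => c u == x) j) (iota 0 n) =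
  \sum_(x <- iota 0 n | c x == x) cut_size M es (fun u => c u == x).
  rewrite /cut_size exchange_big /=; apply: eq_bigr => j _.
  rewrite -sum1_count big_mkcondr /=; apply: eq_bigr => x _.
  by case: cuts.
rewrite /nroots -sum1_count big_distrr /=.
rewrite big_seq_cond [leqRHS]big_seq_cond; apply: leq_sum => x.
rewrite mem_iota add0n muln1 => /andP[xn /eqP cx].
apply: Hlam; have [y yn [cy yx]] := nroots_gt1 cok xn cx m1.
by exists x, y; rewrite cx cy eqxx yx.
Qed.

Lemma nroots1_trivial c S : labelling n c -> nroots n c <= 1 ->
  nontrivial n S -> ~ respects n S c.
Proof.
move=> cok m1 [u [v [un vn Su Sv]]] Sc.
have [cu ccu] := cok u un; have [cv ccv] := cok v vn.
suff cuv : c u = c v by move: Sv; rewrite -(Sc u v) // Su.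
apply/eqP/negPn/negP => ne; move: m1; rewrite leqNgt => /negP; apply.
rewrite /nroots -size_filter.
apply: (@leq_trans (size [:: c u; c v])) => //; apply: uniq_leq_size.
  by rewrite /= inE ne.
by move=> w; rewrite !inE mem_filter mem_iota => /orP[]/eqP->;
  rewrite ?ccu ?ccv eqxx.
Qed.

Lemma nroots_id : nroots n id = n.
Proof.
rewrite /nroots (@eq_count _ _ predT) ?count_predT ?size_iota // => v.
by rewrite /= eqxx.
Qed.

Lemma nroots_gt0 c : 0 < n -> labelling n c -> 0 < nroots n c.
Proof.
move=> n0 cok; have [c0 cc0] := cok 0 n0; rewrite /nroots -has_count.
by apply/hasP; exists (c 0); rewrite ?mem_iota ?cc0.
Qed.

End Hedges.

(** * The greedy packing *)

Record config := Config {
  label : nat -> nat;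
  hits : nat -> nat;
  maxhits : nat }.

Section Algorithm.
Variables (n M : nat) (es : seq (nat * nat * nat)).

Definition drop_roots c j : nat := nroots n c - nroots n (merge_hedge es j c).

(* A candidate is a triple (drop in nroots, weight, hedge). *)
Definition better (c k : nat -> nat) (b : nat * nat * nat) j :=
  if 2 ^ k j * b.1.1 < b.1.2 * drop_roots c j
  then (drop_roots c j, 2 ^ k j, j) else b.

(** The start [(0, 1, 0)] stands for the ratio 1 / 0: it is beaten exactly by the hedges with a
    positive drop. *)
Definition scan m c k := foldl (better c k) (0, 1, 0) (iota 0 m).

Definition incr (k : nat -> nat) j : nat -> nat :=
  fun i => if i == j then (k i).+1 else k i.

Definition greedy_step (g : config) : config :=
  let b := scan M (label g) (hits g) in
  if 0 < b.1.1
  then Config (merge_hedge es b.2 (label g)) (incr (hits g) b.2)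
         (maxn (maxhits g) (hits g b.2).+1)
  else g.

Definition reset g := Config id (hits g) (maxhits g).

(** The number of steps is fixed in advance; steps taken after everything is connected change
    nothing. *)
Definition round X g := iter X greedy_step (reset g).

Definition run X N := iter N (round X) (Config id (fun=> 0) 0).

Definition best_hedge c (k : nat -> nat) j : Prop := [/\ j < M, 0 < drop_roots c j
  & forall i, i < M -> 2 ^ k j * drop_roots c i <= 2 ^ k i * drop_roots c j].

Lemma scanP m c k : let b := scan m c k in
  [/\ 0 < b.1.2, b.1.1 = 0 \/ (b = (drop_roots c b.2, 2 ^ k b.2, b.2) /\ b.2 < m)
    & forall j, j < m -> b.1.2 * drop_roots c j <= 2 ^ k j * b.1.1].
Proof.
rewrite /scan /=; elim: m => [|m IH]; first by split=> //; left.
rewrite -[m.+1]addn1 iotaD foldl_cat add0n /=.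
set b := foldl _ _ (iota 0 m) in IH *; have [w0 fb opt] := IH.
rewrite /better; case: (ltnP (2 ^ k m * b.1.1)) => cmp /=.
  split; [by rewrite expn_gt0 | by right; split=> //; lia |].
  move=> j; rewrite addn1 ltnS leq_eqVlt => /orP[/eqP-> //|jm].
  (* Transitivity of the cross-multiplied comparison: [m] beats [b], which is at least as good as
     [j], and positive weights cancel. *)
  have := opt j jm; rewrite -(leq_pmul2l w0); move: cmp.
  set w := 2 ^ k m; set w' := 2 ^ k j; set f := drop_roots c m.
  have w0' : 0 < w by rewrite expn_gt0.
  by rewrite !leq_pmul2l // => cmp' opt'; rewrite -(leq_pmul2l w0); nia.
split=> //; first by case: fb => [|[? ?]]; [left | right; split=> //; lia].
move=> j; rewrite addn1 ltnS leq_eqVlt => /orP[/eqP-> //|jm]; exact: opt.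
Qed.

(** Case rule behind all invariants of the packing: either a hedge of least ratio is merged, or no
    hedge removes a component. *)
Lemma greedy_stepP (P : config -> Prop) g :
  (forall j, best_hedge (label g) (hits g) j ->
     P (Config (merge_hedge es j (label g)) (incr (hits g) j)
         (maxn (maxhits g) (hits g j).+1))) ->
  ((forall j, j < M -> drop_roots (label g) j = 0) -> P g) ->
  P (greedy_step g).
Proof.
move=> Pstep Pstuck; rewrite /greedy_step.
have [w0 fb opt] := scanP M (label g) (hits g).
set b := scan _ _ _ in w0 fb opt *; case: ifP => [b0|/negbT].
  case: fb => [b00|[bE bM]]; first by rewrite b00 in b0.
  by apply: Pstep; split=> //; move: b0 opt; rewrite bE.
rewrite -eqn0Ngt => /eqP b0; apply: Pstuck => j /opt.
by rewrite b0 muln0 leqn0 muln_eq0 => /orP[/eqP e|/eqP //]; rewrite e in w0.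
Qed.

(** * Labels and components during the rounds *)

Hypothesis es_in : edges_in n M es.

Lemma round_ind (P : config -> Prop) X g :
  (forall g, P g -> P (greedy_step g)) -> P (reset g) -> P (round X g).
Proof. by move=> PS P0; rewrite /round; elim: X => //= X; apply: PS. Qed.

Lemma label_step g :
  labelling n (label g) -> labelling n (label (greedy_step g)).
Proof.
move=> cok; apply: (greedy_stepP (P := fun g => labelling n (label g))) => //.
by move=> j _; apply: (labelling_merge_hedge es_in).
Qed.

Lemma label_run (X N : nat) : labelling n (label (run X N)).
Proof.
case: N => [|N]; first by move=> u un.
apply: (round_ind (P := fun g => labelling n (label g))) => [|u un] //.
exact: label_step.
Qed.

(** This is how connectivity 0 is detected: no merge crosses an uncut [S], so the labelling always
    respects [S]. *)
Lemma run_disconnected X N S : nontrivial n S -> cut_size M es S = 0 ->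
  1 < nroots n (label (run X N)).
Proof.
move=> Snt S0; rewrite ltnNge; apply/negP => m1.
apply: (nroots1_trivial (@label_run X N) m1 Snt).
have noS j : j < M -> ~~ cuts es S j.
  move=> jM; move/eqP: S0; rewrite /cut_size sum_nat_eq0 => /forallP.
  by move=> /(_ (Ordinal jM)); rewrite eqb0.
have resp_id : respects n S id by move=> u v _ _ ->.
case: N {m1} => [|N]; first exact: resp_id.
apply: (round_ind (P := fun g => respects n S (label g))) => // g resp.
apply: (greedy_stepP (P := fun g => respects n S (label g))) => // j [jM _ _].
by apply: (respects_merge_hedge es_in) => //; apply: noS.
Qed.

Variable lam : nat.
Hypothesis lam_gt0 : 0 < lam.
Hypothesis lam_le : forall S, nontrivial n S -> lam <= cut_size M es S.
Hypothesis n_gt1 : 1 < n.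

Lemma some_drop c : labelling n c -> 1 < nroots n c ->
  (forall j, j < M -> drop_roots c j = 0) -> False.
Proof.
move=> cok m1 stuck; have := sum_drop es_in cok m1 lam_le.
rewrite big1 => [|j _]; last exact: stuck.
by rewrite muln0 leqn0 muln_eq0 => /orP[] /eqP; lia.
Qed.

(** While two components remain, [some_drop] guarantees progress, so each step removes at least
    one. *)
Lemma nroots_iter X g :
  nroots n (label (iter X greedy_step (reset g))) <= maxn 1 (n - X).
Proof.
suff H : labelling n (label (iter X greedy_step (reset g))) /\
   nroots n (label (iter X greedy_step (reset g))) <= maxn 1 (n - X) by case: H.
elim: X => [|X [cok IH]].
  by split=> [u|] //; rewrite [label _]/= nroots_id; lia.
rewrite iterS; set g' := iter _ _ _ in cok IH *.
apply: (greedy_stepP (P := fun g =>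
  labelling n (label g) /\ nroots n (label g) <= maxn 1 (n - X.+1))) => /=.
  move=> j [_ d0 _]; split; first exact: (labelling_merge_hedge es_in).
  by move: d0; rewrite /drop_roots; lia.
move=> stuck; split=> //; case: (leqP (nroots n (label g')) 1) => m1; first lia.
by case: (some_drop cok m1 stuck).
Qed.

Lemma nroots_run X N : n <= X -> 0 < N -> nroots n (label (run X N)) <= 1.
Proof.
move=> nX; case: N => // N _; rewrite /run iterS.
by apply: leq_trans (nroots_iter _ _) _; lia.
Qed.

(** * Hits of cuts and the largest number of hits *)

Definition cut_hits S (k : nat -> nat) : nat := \sum_(j < M) cuts es S j * k j.

Lemma cut_hits_incr S k j : j < M ->
  cut_hits S (incr k j) = cuts es S j + cut_hits S k.
Proof.
move=> jM; rewrite /cut_hits (bigD1 (Ordinal jM)) //= [in RHS](bigD1 (Ordinal jM)) //=.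
rewrite /incr eqxx mulnS -addnA; congr (_ + (_ + _)).
by apply: eq_bigr => i; rewrite -val_eqE /= => /negPf ->.
Qed.

(* A spanning collection of hedges meets every cut, so each completed round hits
   each cut at least once. *)
Definition hit_inv r (g : config) : Prop :=
  labelling n (label g) /\ forall S, nontrivial n S ->
    r <= cut_hits S (hits g) /\
    (~ respects n S (label g) -> r < cut_hits S (hits g)).

Lemma hit_inv_step r g : hit_inv r g -> hit_inv r (greedy_step g).
Proof.
move=> [cok H]; apply: (greedy_stepP (P := hit_inv r)) => // j [jM _ _].
split=> [|S Snt] /=; first exact: (labelling_merge_hedge es_in).
have [le lt] := H S Snt; rewrite cut_hits_incr //.
split=> [|nr]; first exact: leq_trans (leq_addl _ _).
case cutj: (cuts es S j) => /=; first by rewrite add1n ltnS.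
(* A hedge that does not cross [S] preserves respect for [S], so the labelling had already stopped
   respecting [S] and the extra hit came earlier. *)
apply: lt => r'; apply: nr; apply: (respects_merge_hedge es_in) => //.
by rewrite cutj.
Qed.

Lemma hit_inv_run X N : n <= X -> hit_inv N (reset (run X N)).
Proof.
move=> nX; elim: N => [|N IH].
  by split=> [u //|S _]; split=> // nr; case: nr => u v _ _ /= ->.
have : hit_inv N (run X N.+1).
  by apply: (round_ind (P := hit_inv N)) => //; apply: hit_inv_step.
move=> [cok H]; split=> [u //|S Snt]; have [_ lt] := H S Snt.
split; last by move=> nr; case: nr => u v _ _ /= ->.
(* The round ends with a single component, which cannot respect [S], so the strict bound applies. *)
exact/lt/(nroots1_trivial cok _ Snt)/nroots_run.
Qed.

(** The bound serves [maxhits_lower], the attainment serves [maxhits_upper]. *)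
Definition max_inv (g : config) : Prop :=
  (forall j, j < M -> hits g j <= maxhits g) /\
  exists2 j, j < M & hits g j = maxhits g.

Lemma max_inv_step g : max_inv g -> max_inv (greedy_step g).
Proof.
move=> [le [i iM iE]]; apply: (greedy_stepP (P := max_inv)) => [j [jM _ _]|_];
  last first.
  by split=> //; exists i.
split=> /=.
  move=> i' i'M; rewrite /incr; case: eqP => [-> |_]; first exact: leq_maxr.
  by apply: leq_trans (le _ i'M) _; apply: leq_maxl.
case: (leqP (maxhits g) (hits g j)) => c.
  by exists j => //; rewrite /incr eqxx; apply/esym/maxn_idPr; lia.
exists i => //; rewrite /incr; case: eqP => [e|_].
  by move: c; rewrite -e iE ltnn.
by rewrite iE; apply/esym/maxn_idPl.
Qed.

Lemma max_inv_run X N : 0 < M -> max_inv (run X N).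
Proof.
move=> M0; elim: N => [|N IH]; first by split=> //; exists 0.
by apply: (round_ind (P := max_inv)) => //; apply: max_inv_step.
Qed.

(** * Total weight and the logarithmic potential *)

Definition weight (k : nat -> nat) : nat := \sum_(j < M) 2 ^ k j.

Lemma weight_incr k j : j < M -> weight (incr k j) = weight k + 2 ^ k j.
Proof.
move=> jM; rewrite /weight (bigD1 (Ordinal jM)) //= [in RHS](bigD1 (Ordinal jM)) //=.
rewrite /incr eqxx expnS mul2n -addnn addnAC; congr (_ + _ + _).
by apply: eq_bigr => i; rewrite -val_eqE /= => /negPf ->.
Qed.

(** Averaging: multiply [sum_drop] by [2 ^ k j], apply the optimality of [j] to each term, and
    sum. *)
Lemma best_hedge_ratio c k j : labelling n c -> best_hedge c k j ->
  lam * 2 ^ k j * nroots n c <= 2 * weight k * drop_roots c j.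
Proof.
move=> cok [jM d0 opt].
have m1 : 1 < nroots n c.
  have := nroots_gt0 (ltnW n_gt1) (labelling_merge_hedge es_in j cok).
  by move: d0; rewrite /drop_roots; lia.
have := sum_drop es_in cok m1 lam_le; rewrite -(leq_pmul2l (expn_gt0 2 (k j))) => le.
rewrite mulnAC [_ * 2 ^ _]mulnC; apply: leq_trans le _.
rewrite mulnCA -mulnA leq_mul2l /= big_distrr big_distrl /=.
by apply: leq_sum => i _; apply: opt.
Qed.


Section Potential.
Import GRing.Theory Num.Theory Order.Theory.
Local Open Scope ring_scope.
Variable R : realType.

(** Concavity of [ln]: its graph lies below the tangent at [x]. *)
Lemma ln_sub_le (x y : R) : 0 < x -> 0 < y -> ln y - ln x <= (y - x) / x.
Proof.
move=> x0 y0; rewrite -ln_div ?posrE //.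
have -> : y / x = 1 + (y - x) / x by field; rewrite gt_eqF.
apply: le_ln1Dx; rewrite -subr_gt0 opprK.
have -> : (y - x) / x + 1 = y / x by field; rewrite gt_eqF.
exact: divr_gt0.
Qed.

(** The coefficients make it nonincreasing: by [best_hedge_ratio], [lam] times the relative growth
    of the weight is at most twice the relative loss of components, and [ln_sub_le] turns both into
    logarithms. *)
Definition potential (g : config) : R :=
  lam%:R * ln (weight (hits g))%:R + 2 * ln (nroots n (label g))%:R.

Lemma potential_step g : labelling n (label g) ->
  potential (greedy_step g) <= potential g.
Proof.
move=> cok; apply: (greedy_stepP
  (P := fun g' => potential g' <= potential g)) => // j bj.
have [jM d0 _] := bj.
have cok' := labelling_merge_hedge es_in j cok.
have m'0 := nroots_gt0 (ltnW n_gt1) cok'.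
have := best_hedge_ratio cok bj.
rewrite /potential /= weight_incr //.
move: d0; rewrite /drop_roots.
set m := nroots n (label g) in m'0 *; set m' := nroots n _ in m'0 *.
set W := weight (hits g); set w := (2 ^ hits g j)%N => d0 ratio.
have w0 : (0 < w)%N by rewrite expn_gt0.
have W0 : (0 < W)%N.
  by rewrite /W /weight (bigD1 (Ordinal jM)) //= addn_gt0 expn_gt0.
have W0R : 0 < W%:R :> R by rewrite ltr0n.
have m0R : 0 < m%:R :> R by rewrite ltr0n; lia.
have ratioR : lam%:R * w%:R * m%:R <= 2 * W%:R * (m%:R - m'%:R) :> R.
  rewrite -natrB; last by lia.
  by rewrite -!natrM ler_nat.
have W'0R : 0 < (W + w)%:R :> R by rewrite ltr0n; lia.
have m'0R : 0 < m'%:R :> R by rewrite ltr0n.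
have hW := ln_sub_le W0R W'0R.
have hm := ln_sub_le m0R m'0R.
rewrite natrD [X in X / _]addrAC subrr add0r in hW; rewrite natrD.
have : lam%:R * (w%:R / W%:R) <= 2 * ((m%:R - m'%:R) / m%:R) :> R.
  rewrite !mulrA ler_pdivrMr // mulrAC ler_pdivlMr //.
  by rewrite [leRHS]mulrAC.
rewrite -[m%:R - m'%:R]opprB mulNr mulrN => h.
have : lam%:R * (ln (W%:R + w%:R) - ln W%:R) <= lam%:R * (w%:R / W%:R) :> R.
  by rewrite ler_wpM2l // addrC.
lra.
Qed.

(** Within a round the potential does not grow; each reset brings the components from 1 back to [n]
    and costs [2 * ln n]. The initial weight is [M]. *)
Lemma potential_run X N : (n <= X)%N ->
  potential (reset (run X N)) <=
    lam%:R * ln M%:R + (2 * N.+1)%:R * ln n%:R.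
Proof.
move=> nX; elim: N => [|N IH].
  rewrite /potential /= nroots_id.
  suff -> : weight (fun=> 0%N) = M by rewrite muln1.
  by rewrite /weight (eq_bigr (fun=> 1%N)) // sum1_card card_ord.
have cok := @label_run X N.+1.
have m1 : nroots n (label (run X N.+1)) = 1%N.
  have := nroots_gt0 (ltnW n_gt1) cok.
  by have := nroots_run nX (isT : 0 < N.+1)%N; lia.
have [_ le] : labelling n (label (run X N.+1)) /\
    potential (run X N.+1) <= potential (reset (run X N)).
  apply: (round_ind (P := fun g => labelling n (label g) /\
    potential g <= potential (reset (run X N)))) => // g [lg le].
  split; first exact: label_step.
  exact: le_trans (potential_step lg) le.
have := le_trans le IH; rewrite /potential m1 ln1 /= nroots_id mulr0 addr0.
rewrite !mulnS !natrD; lra.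
Qed.

Lemma ln2_ge : 1 / 2 <= ln 2 :> R.
Proof.
(* The tangent at 2, evaluated at 1. *)
have := ln_sub_le (ltr0n R 2 : 0 < 2) (@ltr01 R); rewrite ln1; lra.
Qed.

(** The weight is at least [2 ^ maxhits], and [ln n <= L * ln 2] yields the term [2 * L]. The
    initial term is bounded crudely by [ln M <= M * ln 2]; as [M * lam <= N], it costs only the
    additional 1. *)
Lemma maxhits_upper X N L : 
  (0 < M -> n <= X -> n <= 2 ^ L -> M * lam <= N ->
   lam * maxhits (run X N) <= N * (2 * L).+1)%N.
Proof.
move=> M0 nX nL MN; have [_ [j jM jE]] := max_inv_run X N M0.
have := @potential_run X N nX.
rewrite /potential /= nroots_id.
set c := maxhits _ in jE *; set W := weight _.
have cW : (2 ^ c <= W)%N.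
  by rewrite -jE /W /weight (bigD1 (Ordinal jM)) //= leq_addr.
have ln_le (a b : nat) : (0 < a)%N -> (a <= 2 ^ b)%N ->
    ln a%:R <= b%:R * ln 2 :> R.
  move=> a0 ab; rewrite mulr_natl -lnXn // ler_ln ?posrE ?exprn_gt0 ?ltr0n //.
  by rewrite -natrX ler_nat.
have lnW : c%:R * ln 2 <= ln W%:R :> R.
  rewrite mulr_natl -lnXn // ler_ln ?posrE ?exprn_gt0 ?ltr0n //.
    by rewrite -natrX ler_nat.
  by apply: leq_trans cW; rewrite expn_gt0.
have lnM := ln_le M M M0 (ltnW (ltn_expl M (isT : 1 < 2)%N)).
have lnn := ln_le n L (ltnW n_gt1) nL.
have l2 := ln2_ge.
have MNR : M%:R * lam%:R <= N%:R :> R by rewrite -natrM ler_nat.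
have -> : (2 * N.+1)%:R = 2 * N%:R + 2 :> R.
  by rewrite mulnS natrD natrM addrC.
move=> h; suff : lam%:R * c%:R * ln 2 <= N%:R * (2 * L%:R + 1) * ln 2 :> R.
  rewrite ler_pM2r; last by lra.
  by rewrite -natrM -natrM natr1 -natrM ler_nat.
have lam0 : 0 <= lam%:R :> R by [].
have N0 : 0 <= N%:R :> R by [].
have := ler_wpM2l lam0 lnW; have := ler_wpM2l lam0 lnM.
have := ler_wpM2l N0 lnn.
have : M%:R * lam%:R * ln 2 <= N%:R * ln 2 :> R.
  by rewrite ler_wpM2r //; lra.
lra.
Qed.

End Potential.

(** The minimum cut receives at least [N] hits, shared among [lam] hedges with at most [maxhits]
    each. *)
Lemma maxhits_lower X N S : nontrivial n S -> cut_size M es S = lam ->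
  0 < M -> n <= X -> N <= lam * maxhits (run X N).
Proof.
move=> Snt SE M0 nX; have [le _] := max_inv_run X N M0.
have [_ /(_ S Snt) [h _]] := hit_inv_run N nX.
apply: leq_trans h _; rewrite -SE /cut_size big_distrl /=.
by apply: leq_sum => j _; rewrite leq_mul2l le ?orbT.
Qed.

End Algorithm.

(** * The packing as a program *)

(** Prefix [a] marks arrays, [v] scalars and [i] loop counters; the latter two live in cell 0 of an
    array of their own. *)
Local Notation aOut := 1 (only parsing).
Local Notation aHedge := 2 (only parsing).
Local Notation aFst := 3 (only parsing).
Local Notation aSnd := 4 (only parsing).
Local Notation aWeight := 5 (only parsing).
Local Notation aHits := 6 (only parsing).
Local Notation aLabel := 7 (only parsing).
Local Notation aTrial := 8 (only parsing).
Local Notation vN := 11 (only parsing).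
Local Notation vM := 12 (only parsing).
Local Notation vT := 13 (only parsing).
Local Notation iR := 20 (only parsing).
Local Notation iR' := 21 (only parsing).
Local Notation iS := 22 (only parsing).
Local Notation iJ := 23 (only parsing).
Local Notation iT := 24 (only parsing).
Local Notation iU := 25 (only parsing).
Local Notation vMax := 30 (only parsing).
Local Notation vRoots := 31 (only parsing).
Local Notation vDrop := 32 (only parsing).
Local Notation vBDrop := 33 (only parsing).
Local Notation vBWeight := 34 (only parsing).
Local Notation vBest := 35 (only parsing).
Local Notation vCount := 36 (only parsing).
Local Notation vX := 37 (only parsing).
Local Notation vY := 38 (only parsing).
Local Notation vP := 39 (only parsing).
Local Notation vP' := 40 (only parsing).
Local Notation vQ := 41 (only parsing).
Local Notation vL := 42 (only parsing).
Local Notation vPow := 43 (only parsing).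
Local Notation vAcc := 44 (only parsing).

Local Notation var a := (Read a (Const 0)).
Local Notation "a ::= x" := (BWrite a (Const 0) x) (at level 60, x at level 59).
Local Notation "p ;; q" := (BSeq p q) (at level 65, right associativity).
Local Notation less x y := (Defs.Sub y x).
Local Notation equal x y := (Defs.Sub (Const 1) (Add (Defs.Sub x y) (Defs.Sub y x))).
Local Notation plus x y := (Add x y).
Local Notation when x p := (BIf x p BSkip).

(** Every loop runs [X] times, so the body first tests that the counter is in the intended range;
    the same device recurs below. *)
Definition count_roots D :=
  vCount ::= Const 0 ;;
  BFor iU (when (less (var iU) (var vN))
    (when (equal (Read D (var iU)) (var iU))
      (vCount ::= plus (var vCount) (Const 1)))).

(** Both labels are saved first, because the loop overwrites the cells they come from. *)
Definition merge_edge D :=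
  vX ::= Read D (Read aFst (var iT)) ;;
  vY ::= Read D (Read aSnd (var iT)) ;;
  BFor iU (when (less (var iU) (var vN))
    (when (equal (Read D (var iU)) (var vX)) (BWrite D (var iU) (var vY)))).

Definition merge_along D j :=
  BFor iT (when (less (var iT) (var vT))
    (when (equal (Read aHedge (var iT)) (var j)) (merge_edge D))).

Definition copy_labels :=
  BFor iU (when (less (var iU) (var vN))
    (BWrite aTrial (var iU) (Read aLabel (var iU)))).

(** Multiplication by repeated addition. The first factor must be at most [X]: it is always a drop,
    whereas the second is a weight and may be exponential. *)
Definition product r x y :=
  r ::= Const 0 ;;
  BFor iU (when (less (var iU) x) (r ::= plus (var r) y)).

Definition try_hedge :=
  copy_labels ;;
  merge_along aTrial iJ ;;
  count_roots aTrial ;;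
  vDrop ::= Defs.Sub (var vRoots) (var vCount) ;;
  product vP (var vBDrop) (Read aWeight (var iJ)) ;;
  product vP' (var vDrop) (var vBWeight) ;;
  when (less (var vP) (var vP'))
    (vBDrop ::= var vDrop ;;
     vBWeight ::= Read aWeight (var iJ) ;;
     vBest ::= var iJ).

Definition take_best :=
  merge_along aLabel vBest ;;
  BWrite aWeight (var vBest)
    (plus (Read aWeight (var vBest)) (Read aWeight (var vBest))) ;;
  BWrite aHits (var vBest) (plus (Read aHits (var vBest)) (Const 1)) ;;
  when (less (var vMax) (Read aHits (var vBest)))
    (vMax ::= Read aHits (var vBest)).

Definition greedy :=
  count_roots aLabel ;;
  vRoots ::= var vCount ;;
  vBDrop ::= Const 0 ;;
  vBWeight ::= Const 1 ;;
  vBest ::= Const 0 ;;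
  BFor iJ (when (less (var iJ) (var vM)) try_hedge) ;;
  when (less (Const 0) (var vBDrop)) take_best.

Definition reset_labels :=
  BFor iU (when (less (var iU) (var vN)) (BWrite aLabel (var iU) (var iU))).

(** Adding [1 + 2 L] to [vQ] in each round produces the dividend [X ^ 2 * (1 + 2 L)] without a
    multiplication. *)
Definition one_round :=
  reset_labels ;;
  BFor iS greedy ;;
  vQ ::= plus (var vQ) (plus (Const 1) (plus (var vL) (var vL))).

Definition init_weights :=
  BFor iU (when (less (var iU) (var vM))
    (BWrite aWeight (var iU) (Const 1) ;; BWrite aHits (var iU) (Const 0))).

Definition log_n :=
  vL ::= Const 0 ;;
  vPow ::= Const 1 ;;
  BFor iU (when (less (var vPow) (var vN))
    (vPow ::= plus (var vPow) (var vPow) ;; vL ::= plus (var vL) (Const 1))).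

(** Counts the multiples of [vMax] with positive coefficient up to [X] that do not exceed [vQ].
    Truncating the quotient at [X] is harmless, since the connectivity is at most [X]. *)
Definition quotient :=
  vAcc ::= Const 0 ;;
  aOut ::= Const 0 ;;
  BFor iU (vAcc ::= plus (var vAcc) (var vMax) ;;
    BIf (less (var vQ) (var vAcc)) BSkip (aOut ::= plus (var aOut) (Const 1))).

Definition main :=
  init_weights ;;
  vMax ::= Const 0 ;;
  log_n ;;
  vQ ::= Const 0 ;;
  reset_labels ;;
  BFor iR (BFor iR' one_round) ;;
  quotient ;;
  count_roots aLabel ;;
  when (less (Const 1) (var vCount)) (aOut ::= Const 0).

(** * Correctness of the program fragments *)

Lemma sem_less x y p q s :
  sem (BIf (less x y) p q) s = if eval s x < eval s y then sem p s else sem q s.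
Proof. by rewrite [LHS]/= -lt0n subn_gt0. Qed.

Lemma sem_equal x y p q s : sem (BIf (equal x y) p q) s =
  if eval s x == eval s y then sem p s else sem q s.
Proof.
suff <- : (eval s (equal x y) != 0) = (eval s x == eval s y) by [].
by rewrite /=; lia.
Qed.

Lemma sem_seq p q s : sem (BSeq p q) s = sem q (sem p s).
Proof. by []. Qed.

Section Main.
Variables (X n M : nat) (es : seq (nat * nat * nat)).
Hypotheses (es_in : edges_in n M es) (nX : n <= X) (MX : M <= X)
  (TX : size es <= X).

Definition env (s : memory) : Prop :=
  [/\ s lim 0 = X, s vN 0 = n, s vM 0 = M, s vT 0 = size es &
    forall t, t < size es -> let e := nth (0, 0, 0) es t in
      [/\ s aHedge t = e.1.1, s aFst t = e.1.2 & s aSnd t = e.2]].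

Definition env_arrays := [:: lim; vN; vM; vT; aHedge; aFst; aSnd].

Lemma env_eq s s' : env s -> {in env_arrays, forall a, s' a = s a} -> env s'.
Proof.
by move=> [h1 h2 h3 h4 h5] e; split; rewrite ?e.
Qed.

Lemma env_sem p s : ~~ has (mem (writes p)) env_arrays -> env s -> env (sem p s).
Proof.
by move=> /hasPn H E; apply: (env_eq E) => a /H h; rewrite sem_frame.
Qed.

(** Variant of [sem_For_ind] in which the body starts with the counter already set; in return the
    invariant must be insensitive to the counter. *)
Lemma loop_ind (I : nat -> memory -> Prop) c p s :
  env s -> ~~ has (mem (writes (BFor c p))) env_arrays ->
  (forall k t v, I k t -> I k (update t c 0 v)) -> I 0 s ->
  (forall k t, k < X -> t c 0 = k -> env t ->
    (forall a, a \notin writes (BFor c p) -> t a = s a) ->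
    I k t -> I k.+1 (sem p t)) ->
  I X (sem (BFor c p) s).
Proof.
move=> E wE Ic I0 IS; have [sX _ _ _ _] := E.
have [//|k t kX F Ik|t It ->] := @sem_For_ind I c p s; last first.
  by rewrite sX in It *; apply: Ic.
rewrite sX in kX; have F' a : a \notin writes (BFor c p) ->
    update t c 0 k a = s a.
  move=> aP; rewrite update_other; first exact: F.
  by move: aP; rewrite inE negb_or => /andP[].
apply: IS => //; [exact: update_same | | exact: Ic].
by apply: (env_eq E) => a /(hasPn wE) /F'.
Qed.

Definition rep D (c : nat -> nat) (s : memory) : Prop :=
  forall u, u < n -> s D u = c u.

Definition label_array (D : nat) := (D == aLabel) || (D == aTrial).

Lemma count_rootsP D c s : label_array D -> env s -> rep D c s ->
  sem (count_roots D) s vCount 0 = nroots n c.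
Proof.
move=> DE E Dc; rewrite /count_roots sem_seq.
set s1 := sem _ s; have E1 : env s1 by apply: env_sem E.
have D1 : rep D c s1 by case/orP: DE Dc => /eqP ->.
rewrite (@loop_ind (fun k t => t vCount 0 =
  count (fun v => (v < n) && (c v == v)) (iota 0 k)) _ _ _ E1) //.
  (* The loop continues up to [X], but positions from [n] on are not counted. *)
  rewrite -(subnKC nX) iotaD count_cat addnC (eq_in_count (a2 := pred0)); last first.
    by move=> v; rewrite mem_iota => /andP[nv _]; rewrite ltnNge nv.
  rewrite count_pred0; apply: eq_in_count => v; rewrite mem_iota => /andP[_ vn].
  by rewrite vn.
move=> k t kX tk Et F I.
have Dt : rep D c t by move=> u un; rewrite F ?D1 //; case/orP: DE => /eqP ->.
rewrite -[k.+1]addn1 iotaD count_cat -I.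
have [_ tn _ _ _] := Et.
rewrite sem_less sem_equal /= tn tk add0n; case: (ltnP k n) => kn; rewrite ?addn0 //.
by rewrite Dt //=; case: eqP => _ /=; rewrite ?addn0.
Qed.

Lemma merge_edgeP D c s : label_array D -> env s -> rep D c s ->
  s iT 0 < size es -> let e := nth (0, 0, 0) es (s iT 0) in
  rep D (merge_labels c e.1.2 e.2) (sem (merge_edge D) s).
Proof.
move=> DE E Dc tT e; have [_ _ _ _ /(_ _ tT) [_ eF eS]] := E.
have [_ an bn] := es_in (mem_nth (0, 0, 0) tT).
rewrite /merge_edge !sem_seq.
set s1 := sem _ s; set s2 := sem _ s1.
have E2 : env s2 by do 2!apply: env_sem => //.
have D2 : rep D c s2 by case/orP: DE Dc => /eqP ->.
have x2 : s2 vX 0 = c e.1.2.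
  by rewrite /s2 /s1 /=; case/orP: DE Dc => /eqP -> Dc; rewrite /update /= eF Dc.
have y2 : s2 vY 0 = c e.2.
  by rewrite /s2 /s1 /=; case/orP: DE Dc => /eqP -> Dc; rewrite /update /= eS Dc.
move=> u un; rewrite (@loop_ind (fun k t => forall u, u < n ->
  t D u = if u < k then merge_labels c e.1.2 e.2 u else c u) _ _ _ E2) //.
- by rewrite (leq_trans un nX).
- by case/orP: DE => /eqP ->.
- by case/orP: DE => /eqP ->.
move=> k t kX tk Et F I v vn.
have [_ tn _ _ _] := Et.
have tx : t vX 0 = c e.1.2 by rewrite F //; case/orP: DE => /eqP ->.
have ty : t vY 0 = c e.2 by rewrite F //; case/orP: DE => /eqP ->.
rewrite sem_less sem_equal /= tn tk tx ty.
rewrite [v < k.+1]ltnS [v <= k]leq_eqVlt.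
case: (ltnP k n) => kn; last first.
  by rewrite I // (leq_trans vn kn) orbT.
rewrite I // ltnn; case: (eqVneq v k) => [->|vk] /=.
  rewrite /merge_labels; case: eqP => _; last by rewrite I // ltnn.
  by rewrite update_same.
by case: eqP => _; rewrite ?update_cell // I.
Qed.

Lemma merge_alongP D j c s : label_array D -> env s -> rep D c s ->
  (j == iJ) || (j == vBest) ->
  rep D (merge_hedge es (s j 0) c) (sem (merge_along D j) s).
Proof.
move=> DE E Dc jE.
(* After [k] iterations the first [k] edges are processed, and [X] iterations cover them all. *)
rewrite -[es in merge_hedge es](take_oversize TX).
apply: (@loop_ind (fun k t => rep D (merge_hedge (take k es) (s j 0) c) t) _ _ _ E).
- by case/orP: DE => /eqP ->.
- by case/orP: DE => /eqP ->.
- by rewrite take0.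
move=> k t kX tk Et F I.
have [_ _ _ tT eT] := Et.
have tj : t j 0 = s j 0.
  by rewrite F //; case/orP: DE => /eqP ->; case/orP: jE => /eqP ->.
rewrite sem_less sem_equal /= tT tk tj; case: (ltnP k (size es)) => kT; last first.
  by rewrite take_oversize in I *; rewrite ?take_oversize // (leq_trans kT).
have [eH _ _] := eT k kT.
rewrite (take_nth (0, 0, 0)) // /merge_hedge foldl_rcons /merge_step.
rewrite eH; case: eqP => _ //.
rewrite -tk; apply: merge_edgeP => //; rewrite ?tk //.
Qed.

Lemma copy_labelsP c s : env s -> rep aLabel c s ->
  rep aTrial c (sem copy_labels s).
Proof.
move=> E Dc.
suff H u : u < n -> u < X -> sem copy_labels s aTrial u = c u.
  by move=> u un; apply: H => //; apply: leq_trans nX.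
move: u; apply: (@loop_ind (fun k t => forall u, u < n -> u < k ->
  t aTrial u = c u) _ _ _ E) => //.
move=> k t kX tk Et F I v vn.
have [_ tn _ _ _] := Et.
rewrite sem_less /= tn tk [v < k.+1]ltnS [v <= k]leq_eqVlt.
case: (ltnP k n) => kn; last first.
  by move=> /orP[/eqP vk|]; [lia | exact: I].
case: (eqVneq v k) => [-> _|vk /= vk']; first by rewrite update_same F ?Dc.
by rewrite update_cell // I.
Qed.

Lemma productP r x y s a b : env s -> (r == vP) || (r == vP') -> a <= X ->
  (forall t, (forall i, i \notin [:: iU; r] -> t i = s i) ->
     eval t x = a /\ eval t y = b) ->
  sem (product r x y) s r 0 = a * b.
Proof.
move=> E rE aX xy; rewrite /product sem_seq.
set s1 := sem _ s; have E1 : env s1.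
  by case/orP: rE => /eqP re; rewrite /s1 re; apply: env_sem E.
rewrite (@loop_ind (fun k t => t r 0 = minn k a * b) _ _ _ E1).
- by rewrite (minn_idPr aX).
- by case/orP: rE => /eqP ->.
- by case/orP: rE => /eqP ->.
- by rewrite /s1 /= update_same min0n.
move=> k t kX tk Et F I.
have [] := xy t.
  move=> i; rewrite !inE negb_or => /andP[iu ir].
  by rewrite F /= ?inE ?negb_or ?iu ?ir // /s1 /= update_other.
rewrite sem_less => xE yE; rewrite /= xE yE tk; case: (ltnP k a) => ka.
  rewrite update_same I; nia.
rewrite I; nia.
Qed.

Definition wrep (k : nat -> nat) (s : memory) : Prop :=
  forall j, j < M -> s aWeight j = 2 ^ k j /\ s aHits j = k j.

Lemma nroots_le c : nroots n c <= n.
Proof. by rewrite -[leqRHS](size_iota 0) count_size. Qed.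

Lemma try_hedgeP c k s b : env s -> rep aLabel c s -> wrep k s ->
  s vRoots 0 = nroots n c -> s iJ 0 < M ->
  (s vBDrop 0, s vBWeight 0, s vBest 0) = b -> b.1.1 <= X ->
  let s' := sem try_hedge s in
  (s' vBDrop 0, s' vBWeight 0, s' vBest 0) = better n es c k b (s iJ 0).
Proof.
move=> E Dc kE mE jM bE bX; rewrite /try_hedge 6!sem_seq.
set s1 := sem copy_labels s; set s2 := sem _ s1; set s3 := sem _ s2.
set s4 := sem _ s3; set s5 := sem _ s4; set s6 := sem _ s5.
have E1 : env s1 by apply: env_sem.
have E2 : env s2 by apply: env_sem.
have E3 : env s3 by apply: env_sem.
have E4 : env s4 by apply: env_sem.
have E5 : env s5 by apply: env_sem.
have D1 : rep aTrial c s1 by apply: copy_labelsP.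
have D2 : rep aTrial (merge_hedge es (s iJ 0) c) s2.
  have -> : s iJ 0 = s1 iJ 0 by rewrite /s1 sem_frame.
  exact: merge_alongP.
have c3 : s3 vCount 0 = nroots n (merge_hedge es (s iJ 0) c).
  by apply: count_rootsP.
have m3 : s3 vRoots 0 = nroots n c by rewrite /s3 /s2 /s1 !sem_frame.
have f4 : s4 vDrop 0 = drop_roots n es c (s iJ 0).
  by rewrite /s4 /= /update /= m3 c3.
have [w0 _] := kE _ jM.
have p5 : s5 vP 0 = b.1.1 * 2 ^ k (s iJ 0).
  apply: productP => // t F; rewrite -bE -w0 /= !F //.
  by rewrite /s4 /s3 /s2 /s1 !sem_frame.
have p6 : s6 vP' 0 = drop_roots n es c (s iJ 0) * b.1.2.
  apply: productP => // [|t F].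
    by rewrite (leq_trans _ nX) // (leq_trans (leq_subr _ _)) // nroots_le.
  rewrite -bE -f4 /= !F //.
  by split; [rewrite /s5 sem_frame | rewrite /s5 /s4 /s3 /s2 /s1 !sem_frame].
have p6' : s6 vP 0 = s5 vP 0 by rewrite /s6 sem_frame.
have d6 : s6 vDrop 0 = drop_roots n es c (s iJ 0) by rewrite /s6 /s5 !sem_frame.
have j6 : s6 iJ 0 = s iJ 0 by rewrite /s6 /s5 /s4 /s3 /s2 /s1 !sem_frame.
have w6 : s6 aWeight (s iJ 0) = 2 ^ k (s iJ 0).
  by rewrite -w0 /s6 /s5 /s4 /s3 /s2 /s1 !sem_frame.
have b6 : (s6 vBDrop 0, s6 vBWeight 0, s6 vBest 0) = b.
  by rewrite -bE /s6 /s5 /s4 /s3 /s2 /s1 !sem_frame.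
rewrite sem_less /better [eval _ _]/= [eval _ (var vP')]/= p6' p5 p6.
rewrite [b.1.1 * _]mulnC [_ * b.1.2]mulnC; case: ifP => _; last by rewrite -b6.
by rewrite !sem_seq /= /update /= d6 j6 w6.
Qed.

Definition srep (g : config) (s : memory) : Prop :=
  [/\ env s, rep aLabel (label g) s, wrep (hits g) s & s vMax 0 = maxhits g].

Lemma take_bestP g s j : srep g s -> s vBest 0 = j -> j < M ->
  srep (Config (merge_hedge es j (label g)) (incr (hits g) j)
    (maxn (maxhits g) (hits g j).+1)) (sem take_best s).
Proof.
move=> [E Dc kE mE] jE jM; rewrite /take_best 3!sem_seq.
set s1 := sem _ s; set s2 := sem _ s1; set s3 := sem _ s2.
have E1 : env s1 by apply: env_sem.
have E2 : env s2 by apply: env_sem.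
have E3 : env s3 by apply: env_sem.
have D1 : rep aLabel (merge_hedge es j (label g)) s1.
  by rewrite -jE; apply: merge_alongP.
have j1 : s1 vBest 0 = j by rewrite /s1 sem_frame.
have w1 i : s1 aWeight i = s aWeight i by rewrite /s1 sem_frame.
have h1 i : s1 aHits i = s aHits i by rewrite /s1 sem_frame.
have m1 : s1 vMax 0 = maxhits g by rewrite /s1 sem_frame.
have k3 : wrep (incr (hits g) j) s3.
  move=> i iM; rewrite /s3 /s2 /= /update /= j1 w1 h1 /incr.
  have [wi hi] := kE i iM; have [wj hj] := kE j jM.
  case: (eqVneq i j) => [->|ij]; last by rewrite w1 h1.
  by rewrite wj hj addn1 expnS mul2n addnn.
have j3 : s3 vBest 0 = j by rewrite /s3 /s2 !sem_frame.
have [_ h3] := k3 j jM; rewrite /incr eqxx in h3.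
have m3 : s3 vMax 0 = maxhits g by rewrite /s3 /s2 !sem_frame.
split; first exact: env_sem.
- by move=> u un; rewrite sem_frame // /s3 /s2 !sem_frame // D1.
- by move=> i iM; rewrite !sem_frame //; apply: k3.
rewrite sem_less [eval _ _]/= [eval _ (Read _ _)]/= j3 h3 m3.
case: (ltnP (maxhits g) _) => lt; last by rewrite [sem _ _]/= m3.
by rewrite /= /update /= j3 h3.
Qed.

Lemma scanS m c k : scan n es m.+1 c k = better n es c k (scan n es m c k) m.
Proof. by rewrite /scan -[m.+1]addn1 iotaD foldl_cat. Qed.

Lemma greedyP g s : srep g s -> srep (greedy_step n M es g) (sem greedy s).
Proof.
move=> [E Dc kE mE]; rewrite /greedy 6!sem_seq.
set s1 := sem _ s; set s2 := sem _ s1; set s3 := sem _ s2; set s4 := sem _ s3.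
set s5 := sem _ s4; set s6 := sem _ s5.
have E5 : env s5 by do 5!apply: env_sem => //.
have E6 : env s6 by apply: env_sem.
have c1 : s1 vCount 0 = nroots n (label g) by apply: count_rootsP.
have r5 : s5 vRoots 0 = nroots n (label g).
  by rewrite /s5 /s4 /s3 !sem_frame // -c1.
pose best (t : memory) := (t vBDrop 0, t vBWeight 0, t vBest 0).
have b6 : best s6 = scan n es M (label g) (hits g).
  rewrite -[M in RHS](minn_idPr MX).
  apply: (@loop_ind (fun k t => best t =
    scan n es (minn k M) (label g) (hits g)) _ _ _ E5) => //; first by rewrite min0n.
  move=> k t kX tk Et F I; have [_ _ tM _ _] := Et.
  rewrite sem_less [eval _ _]/= [eval _ (var vM)]/= tk tM.
  case: (ltnP k M) => kM; last first.
    by rewrite I (minn_idPr kM) (minn_idPr (ltnW _)).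
  have mk : minn k M = k by apply/minn_idPl/ltnW.
  have mk' : minn k.+1 M = k.+1 by apply/minn_idPl.
  rewrite mk in I; rewrite mk' scanS -tk.
  apply: try_hedgeP => //; rewrite ?tk //.
  - by move=> u un; rewrite F // /s5 /s4 /s3 /s2 /s1 !sem_frame // Dc.
  - by move=> j jM; rewrite !F // /s5 /s4 /s3 /s2 /s1 !sem_frame //; apply: kE.
  - by rewrite F.
  have [_ + _] := scanP n es k (label g) (hits g).
  set b := scan _ _ _ _ _ => - [->//|[-> _]] /=.
  by rewrite (leq_trans _ nX) // (leq_trans (leq_subr _ _)) // nroots_le.
have S6 : srep g s6.
  split=> //.
  - by move=> u un; rewrite /s6 /s5 /s4 /s3 /s2 /s1 !sem_frame // Dc.
  - by move=> j jM; rewrite /s6 /s5 /s4 /s3 /s2 /s1 !sem_frame //; apply: kE.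
  - by rewrite /s6 /s5 /s4 /s3 /s2 /s1 !sem_frame.
rewrite sem_less [eval _ _]/= [eval _ (var _)]/= /greedy_step.
have -> : s6 vBDrop 0 = (best s6).1.1 by [].
rewrite b6; have [_ + _] := scanP n es M (label g) (hits g).
set b := scan _ _ _ _ _ in b6 *; case: (ltnP 0 b.1.1) => // b0 [b00|[_ bM]].
  by rewrite b00 in b0.
by apply: take_bestP => //; rewrite -b6.
Qed.

Lemma reset_labelsP s : env s -> rep aLabel id (sem reset_labels s).
Proof.
move=> E.
suff H u : u < n -> u < X -> sem reset_labels s aLabel u = u.
  by move=> u un; apply: H => //; apply: leq_trans nX.
move: u; apply: (@loop_ind (fun k t => forall u, u < n -> u < k ->
  t aLabel u = u) _ _ _ E) => //.
move=> k t kX tk Et F I v vn.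
have [_ tn _ _ _] := Et.
rewrite sem_less /= tn tk [v < k.+1]ltnS [v <= k]leq_eqVlt.
case: (ltnP k n) => kn; last first.
  by move=> /orP[/eqP vk|]; [lia | exact: I].
case: (eqVneq v k) => [-> _|vk /= vk']; first by rewrite update_same.
by rewrite update_cell // I.
Qed.

Lemma one_roundP L g s : srep g s -> s vL 0 = L ->
  let s' := sem one_round s in
  [/\ srep (round n M es X g) s', s' vL 0 = L & s' vQ 0 = s vQ 0 + (2 * L).+1].
Proof.
move=> [E Dc kE mE] sL; rewrite /one_round 2!sem_seq.
set s1 := sem _ s; set s2 := sem _ s1.
have E1 : env s1 by apply: env_sem.
have E2 : env s2 by apply: env_sem.
have S1 : srep (reset g) s1.
  split=> //; first exact: reset_labelsP.
  - by move=> j jM; rewrite /s1 !sem_frame //; apply: kE.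
  - by rewrite /s1 sem_frame.
have [_ D2 k2 m2] : srep (round n M es X g) s2.
  apply: (@loop_ind (fun k t => srep (iter k (greedy_step n M es) (reset g)) t)
    _ _ _ E1) => //.
  by move=> k t kX tk Et F I; rewrite iterS; apply: greedyP.
have L2 : s2 vL 0 = L by rewrite /s2 /s1 !sem_frame.
have Q2 : s2 vQ 0 = s vQ 0 by rewrite /s2 /s1 !sem_frame.
split; [split=> // | by rewrite sem_frame |].
- by rewrite /= /update /= Q2 L2; lia.
Qed.

Lemma init_weightsP s : env s -> wrep (fun=> 0) (sem init_weights s).
Proof.
move=> E.
suff H u : u < M -> u < X -> sem init_weights s aWeight u = 1 /\
    sem init_weights s aHits u = 0.
  by move=> u un; apply: H => //; apply: leq_trans MX.
move: u; apply: (@loop_ind (fun k t => forall u, u < M -> u < k ->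
  t aWeight u = 1 /\ t aHits u = 0) _ _ _ E) => //.
move=> k t kX tk Et F I v vn.
have [_ _ tM _ _] := Et.
rewrite sem_less [eval _ _]/= [eval _ (var vM)]/= tM tk [v < k.+1]ltnS.
rewrite [v <= k]leq_eqVlt; case: (ltnP k M) => kn; last first.
  by move=> /orP[/eqP vk|]; [lia | exact: I].
rewrite sem_seq /= /update /= tk.
by case: (eqVneq v k) => [-> _|vk /= vk'] //; apply: I.
Qed.

Lemma log_nP s : env s ->
  let L := sem log_n s vL 0 in n <= 2 ^ L /\ (0 < L -> 2 ^ L.-1 < n).
Proof.
move=> E; rewrite /log_n 2!sem_seq.
set s1 := sem _ s; set s2 := sem _ s1.
have E2 : env s2 by do 2!apply: env_sem => //.
pose I k (t : memory) := [/\ t vPow 0 = 2 ^ t vL 0,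
    0 < t vL 0 -> 2 ^ (t vL 0).-1 < n & n <= t vPow 0 \/ t vL 0 = k].
set p := BFor _ _; have : I X (sem p s2).
  apply: (@loop_ind I _ _ _ E2) => //; first by split=> //; right.
  move=> k t kX tk Et F [p1 p2 p3]; have [_ tn _ _ _] := Et.
  rewrite sem_less [eval _ _]/= [eval _ (var vN)]/= tn.
  case: (ltnP (t vPow 0) n) => pn; last by split=> //; left.
  rewrite sem_seq /= /update /=; split.
  - by rewrite p1 addn1 expnS mul2n addnn.
  - by rewrite addn1 /= -p1.
  - by case: p3 => [|->]; [lia | right; rewrite addn1].
case=> p1 p2 [p3|p3]; split=> //; first by rewrite -p1.
(* If doubling never stopped, then [L = X] and [n <= X < 2 ^ X]. *)
by rewrite p3 (leq_trans nX) // ltnW // ltn_expl.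
Qed.

Lemma quotientP s : env s -> let q := sem quotient s aOut 0 in
  [/\ q * s vMax 0 <= s vQ 0 &
    forall i, i <= X -> i * s vMax 0 <= s vQ 0 -> i <= q].
Proof.
move=> E; rewrite /quotient 2!sem_seq.
set s1 := sem _ s; set s2 := sem _ s1.
have E2 : env s2 by do 2!apply: env_sem => //.
pose I k (t : memory) := [/\ t vAcc 0 = k * s vMax 0, t aOut 0 <= k,
    t aOut 0 * s vMax 0 <= s vQ 0 &
    forall i, i <= k -> i * s vMax 0 <= s vQ 0 -> i <= t aOut 0].
set p := BFor _ _; have : I X (sem p s2).
  apply: (@loop_ind I _ _ _ E2) => //.
  move=> k t kX tk Et F [p1 p0 p2 p3].
  have tm : t vMax 0 = s vMax 0 by rewrite F.
  have tq : t vQ 0 = s vQ 0 by rewrite F.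
  rewrite sem_seq; set t1 := sem _ t.
  have a1 : t1 vAcc 0 = k.+1 * s vMax 0.
    by rewrite /t1 /= /update /= p1 tm mulSn addnC.
  have q1 : t1 vQ 0 = s vQ 0 by rewrite /t1 sem_frame.
  have o1 : t1 aOut 0 = t aOut 0 by rewrite /t1 sem_frame.
  rewrite sem_less [eval _ _]/= [eval _ (var vAcc)]/= q1 a1.
  case: ltnP => c.
    rewrite /I [sem _ _]/= a1 o1; split=> //; first exact: leqW.
    move=> i; rewrite leq_eqVlt => /orP[/eqP -> |]; last exact: p3.
    by rewrite leqNgt c.
  (* If [k.+1] times [vMax] fits into [vQ], so does [k] times, hence every earlier iteration
     counted. *)
  have ok : t aOut 0 = k.
    apply/eqP; rewrite eqn_leq p0 p3 //; apply: leq_trans c.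
    by rewrite leq_mul2r leqnSn orbT.
  by rewrite /I /= /update /= a1 o1 ok addn1.
by case.
Qed.

Lemma mainP s : env s -> exists L q, let g := run n M es X (X * X) in
  [/\ n <= 2 ^ L, 0 < L -> 2 ^ L.-1 < n,
      q * maxhits g <= X * X * (2 * L).+1,
      forall i, i <= X -> i * maxhits g <= X * X * (2 * L).+1 -> i <= q &
      sem main s aOut 0 = if 1 < nroots n (label g) then 0 else q].
Proof.
move=> E; rewrite /main 8!sem_seq.
set s1 := sem _ s; set s2 := sem _ s1; set s3 := sem _ s2; set s4 := sem _ s3.
set s5 := sem _ s4; set s6 := sem _ s5; set s7 := sem _ s6; set s8 := sem _ s7.
have E2 : env s2 by do 2!apply: env_sem => //.
have E3 : env s3 by apply: env_sem.
have E4 : env s4 by apply: env_sem.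
have E5 : env s5 by apply: env_sem.
have [nL Ln] := log_nP E2; set L := s3 vL 0 in nL Ln.
have S5 : srep (run n M es X 0) s5.
  split=> //; first exact: reset_labelsP.
  - have k1 := init_weightsP E.
    by move=> j jM; rewrite /s5 /s4 /s3 /s2 !sem_frame //; apply: k1.
  - by rewrite /s5 /s4 /s3 !sem_frame.
have L5 : s5 vL 0 = L by rewrite /s5 /s4 !sem_frame.
have Q5 : s5 vQ 0 = 0 by rewrite /s5 !sem_frame.
pose I N (t : memory) := [/\ srep (run n M es X N) t, t vL 0 = L &
  t vQ 0 = N * (2 * L).+1].
have [S6 L6 Q6] : I (X * X) s6.
  (* Outer iteration [k] starts after [k * X] rounds; the inner loop adds its own counter. *)
  apply: (@loop_ind (fun k t => I (k * X) t) _ _ _ E5) => //.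
  move=> k t kX tk Et F Ik; rewrite mulSn addnC.
  apply: (@loop_ind (fun j t => I (k * X + j) t) _ _ _ Et) => //.
    by rewrite addn0.
  move=> j t' jX tj Et' F' [St Lt Qt]; rewrite addnS.
  have [? ? Q'] := one_roundP St Lt.
  by split=> //; rewrite Q' Qt mulSn addnC.
have [E6 D6 _ m6] := S6.
have [q1 q2] := quotientP E6.
exists L, (s7 aOut 0); split=> //; first by rewrite -m6 -Q6.
  by move=> i iX; rewrite -m6 -Q6; apply: q2.
have E7 : env s7 by apply: env_sem.
have D7 : rep aLabel (label (run n M es X (X * X))) s7.
  by move=> u un; rewrite /s7 sem_frame // D6.
have c8 : s8 vCount 0 = nroots n (label (run n M es X (X * X))).
  by apply: count_rootsP.
rewrite sem_less [eval _ _]/= [eval _ (var vCount)]/= c8.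
by case: ifP => // _; rewrite [sem BSkip _]/= /s8 sem_frame.
Qed.

End Main.

(** * Reading the input *)

Local Notation aIn := 0 (only parsing).
Local Notation vPos := 14 (only parsing).
Local Notation vHedges := 15 (only parsing).
Local Notation vHyper := 16 (only parsing).
Local Notation vVert := 17 (only parsing).
Local Notation vFirst := 18 (only parsing).

(** Consumes one input cell; the counters of pending vertices, hyperedges and hedges tell what it
    means. [vFirst] peeks at the cell after a hyperedge size, and for an empty hyperedge the peeked
    value is overwritten before any use. *)
Definition parse_step :=
  BIf (less (Const 0) (var vVert))
    (BWrite aHedge (var vT) (var vHedges) ;;
     BWrite aFst (var vT) (var vFirst) ;;
     BWrite aSnd (var vT) (Read aIn (var vPos)) ;;
     vT ::= plus (var vT) (Const 1) ;;
     vVert ::= Defs.Sub (var vVert) (Const 1))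
  (BIf (less (Const 0) (var vHyper))
    (vHyper ::= Defs.Sub (var vHyper) (Const 1) ;;
     vVert ::= Read aIn (var vPos) ;;
     vFirst ::= Read aIn (plus (var vPos) (Const 1)))
    (vHedges ::= Defs.Sub (var vHedges) (Const 1) ;;
     vHyper ::= Read aIn (var vPos))) ;;
  vPos ::= plus (var vPos) (Const 1).

Definition parse_guard :=
  plus (var vHedges) (plus (var vHyper) (var vVert)).

(** A plain [While], since the trip count is unknown: parsing is what measures the input. [parses]
    below counts its steps. *)
Definition parse_loop := While parse_guard (compile parse_step).

Inductive parses : nat -> memory -> memory -> Prop :=
| parses_refl s : parses 0 s s
| parses_step k s s' : eval s parse_guard != 0 ->
    parses k (sem parse_step s) s' -> parses k.+1 s s'.

Lemma parses_trans k1 k2 s1 s2 s3 :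
  parses k1 s1 s2 -> parses k2 s2 s3 -> parses (k1 + k2) s1 s3.
Proof. by elim=> // k s s' g _ IH /IH; apply: parses_step. Qed.

Lemma parses_frame k s s' a : parses k s s' ->
  a \notin writes parse_step -> s' a = s a.
Proof. by elim=> // {}k {}s {}s' _ _ IH aN; rewrite IH // sem_frame. Qed.

Lemma parses_exec k s s' : parses k s s' -> eval s' parse_guard = 0 ->
  exists2 t, exec parse_loop s t s' &
    t <= k.+1 * (cost parse_guard + time 0 parse_step).+1.
Proof.
elim=> [{}s g0|{}k {}s {}s' g1 _ IH g0].
  exists (cost parse_guard).+1; first exact: exec_while_stop.
  by rewrite mul1n ltnS leq_addr.
have [t1 E1 T1] := @exec_sem (s lim 0) parse_step s isT erefl isT.
have [t2 E2 T2] := IH g0.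
exists (cost parse_guard + t1 + t2).+1; first exact: exec_while_loop E1 E2.
(* [parse_step] has no loop, so its time bound does not depend on [lim]. *)
have : t1 <= time 0 parse_step by [].
move: T2; rewrite [k.+2 * _]mulSn; lia.
Qed.

Definition enc_hyperedge (h : seq nat) := size h :: h.
Definition enc_hedge (e : seq (seq nat)) :=
  size e :: flatten (map enc_hyperedge e).
Definition enc_hedges (l : seq (seq (seq nat))) := flatten (map enc_hedge l).

(* Hedges are numbered by the number of hedges that follow them in the list. *)
Definition hyperedge_edges j (h : seq nat) : seq (nat * nat * nat) :=
  [seq (j, head 0 h, v) | v <- h].
(** Each hyperedge becomes a star at its first vertex, with a loop at the centre. A set splits the
    hyperedge exactly when it separates some edge of the star, and there is one edge per vertex. *)
Definition hedge_edges j e := flatten (map (hyperedge_edges j) e).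
Fixpoint edge_list (l : seq (seq (seq nat))) :=
  if l is e :: l' then hedge_edges (size l') e ++ edge_list l' else [::].

Section Parse.
Variable w : seq nat.

Definition stores_edges (es : seq (nat * nat * nat)) (s : memory) : Prop :=
  s vT 0 = size es /\ forall t, t < size es -> let e := nth (0, 0, 0) es t in
    [/\ s aHedge t = e.1.1, s aFst t = e.1.2 & s aSnd t = e.2].

Definition parse_state j ne nv pos es (s : memory) : Prop :=
  [/\ forall i, s aIn i = nth 0 w i, s vHedges 0 = j, s vHyper 0 = ne, s vVert 0 = nv
    & s vPos 0 = pos] /\ stores_edges es s.

Lemma drop_nth pos x r : drop pos w = x :: r ->
  nth 0 w pos = x /\ drop pos.+1 w = r.
Proof.
move=> e; split; first by rewrite -[pos]addn0 -nth_drop e.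
by rewrite -[pos.+1]add1n -drop_drop e /= drop0.
Qed.

Lemma parse_vertices vs rest j ne pos f es s :
  parse_state j ne (size vs) pos es s -> s vFirst 0 = f ->
  drop pos w = vs ++ rest ->
  exists s', [/\ parses (size vs) s s', drop (pos + size vs) w = rest &
    parse_state j ne 0 (pos + size vs) (es ++ [seq (j, f, v) | v <- vs]) s'].
Proof.
elim: vs pos es s => [|v vs IH] pos es s.
  move=> S _ /= d; exists s; rewrite addn0 cats0; split=> //; exact: parses_refl.
move=> [[sI sj sne snv spos] [sT sE]] sf /drop_nth[wv d].
set s1 := sem parse_step s.
have S1 : parse_state j ne (size vs) pos.+1 (rcons es (j, f, v)) s1.
  rewrite /s1 /parse_step sem_seq sem_less [eval _ _]/= [eval _ (var _)]/= snv /=.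
  split; first by split; rewrite /update /= ?spos ?addn1 ?snv ?subn1.
  split; rewrite /update /= sT; first by rewrite size_rcons addn1.
  move=> t; rewrite size_rcons ltnS leq_eqVlt nth_rcons.
  case: (eqVneq t (size es)) => [->|ne'] /=.
    by rewrite ltnn /= sj sf sI spos wv.
  by move=> tT; rewrite tT; apply: sE.
have f1 : s1 vFirst 0 = f.
  by rewrite /s1 /parse_step sem_seq sem_less [eval _ _]/= [eval _ (var _)]/= snv.
have g : eval s parse_guard != 0 by rewrite /= snv /=; lia.
have [s' [P d' S']] := IH _ _ _ S1 f1 d.
exists s'; split; first exact: parses_step P.
  by rewrite -d' addSnnS.
by move: S'; rewrite /= -addSnnS -cats1 -catA.
Qed.

Lemma parse_hyperedges e rest j pos es s :
  parse_state j (size e) 0 pos es s ->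
  drop pos w = flatten (map enc_hyperedge e) ++ rest ->
  exists s', let k := size (flatten (map enc_hyperedge e)) in
    [/\ parses k s s', drop (pos + k) w = rest &
    parse_state j 0 0 (pos + k) (es ++ hedge_edges j e) s'].
Proof.
elim: e pos es s => [|h e IH] pos es s.
  by move=> S d; exists s; rewrite /= addn0 cats0; split=> //; apply: parses_refl.
move=> [[sI sj sne snv spos] SE] /= /drop_nth[wv d].
set s1 := sem parse_step s.
have s1E : s1 = sem (vHyper ::= Defs.Sub (var vHyper) (Const 1) ;;
     vVert ::= Read aIn (var vPos) ;;
     vFirst ::= Read aIn (plus (var vPos) (Const 1)) ;;
     vPos ::= plus (var vPos) (Const 1)) s.
  rewrite /s1 /parse_step sem_seq sem_less [eval _ _]/= [eval _ (var _)]/= snv.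
  by rewrite sem_less [eval _ _]/= [eval _ (var _)]/= sne.
have S1 : parse_state j (size e) (size h) pos.+1 es s1.
  rewrite s1E; split=> //.
  by split=> //=; rewrite /update /= ?sI ?spos ?wv ?addn1 ?sne ?subn1.
have g : eval s parse_guard != 0 by rewrite /= sne /=; lia.
rewrite -catA in d.
have [s2 [P2 d2 S2]] := parse_vertices S1 erefl d.
have [s' [P' d' S']] := IH _ _ _ S2 d2.
exists s'; rewrite size_cat addnS -addSn addnA; split=> //.
  by apply: parses_step => //; apply: parses_trans P2 P'.
move: S'; rewrite /hedge_edges /= catA.
(* For a nonempty [h] the peeked value is its head; for an empty [h] both lists are empty. *)
suff -> : [seq (j, s1 vFirst 0, v) | v <- h] = hyperedge_edges j h by [].
case: (h) d => // v h' d; congr map.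
have [wv' _] := drop_nth d.
by rewrite s1E /= /update /= spos addn1 sI wv'.
Qed.

Lemma parse_hedges l rest pos es s :
  parse_state (size l) 0 0 pos es s ->
  drop pos w = enc_hedges l ++ rest ->
  exists s', let k := size (enc_hedges l) in
    [/\ parses k s s', drop (pos + k) w = rest &
    parse_state 0 0 0 (pos + k) (es ++ edge_list l) s'].
Proof.
elim: l pos es s => [|e l IH] pos es s.
  by move=> S d; exists s; rewrite /= addn0 cats0; split=> //; apply: parses_refl.
move=> [[sI sj sne snv spos] SE] /= /drop_nth[wv d].
set s1 := sem parse_step s.
have s1E : s1 = sem (vHedges ::= Defs.Sub (var vHedges) (Const 1) ;;
     vHyper ::= Read aIn (var vPos) ;;
     vPos ::= plus (var vPos) (Const 1)) s.
  rewrite /s1 /parse_step sem_seq sem_less [eval _ _]/= [eval _ (var _)]/= snv.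
  by rewrite sem_less [eval _ _]/= [eval _ (var _)]/= sne.
have S1 : parse_state (size l) (size e) 0 pos.+1 es s1.
  rewrite s1E; split=> //.
  by split=> //=; rewrite /update /= ?sI ?spos ?wv ?addn1 ?sj ?subn1.
have g : eval s parse_guard != 0 by rewrite /= sj /=; lia.
rewrite -catA in d.
have [s2 [P2 d2 S2]] := parse_hyperedges S1 d.
have [s' [P' d' S']] := IH _ _ _ S2 d2.
exists s'; rewrite size_cat addnS -addSn addnA; split=> //.
  by apply: parses_step => //; apply: parses_trans P2 P'.
by move: S'; rewrite -catA.
Qed.

End Parse.

(** * The whole program and its running time *)

Definition parse_init :=
  vN ::= Read aIn (Const 0) ;;
  vM ::= Read aIn (Const 1) ;;
  vHedges ::= Read aIn (Const 1) ;;
  vPos ::= Const 2.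

(** With fewer edges than vertices some vertex is isolated and the connectivity is 0. The test also
    secures [n <= X] for [main]: [n] is a single number in the input and may exceed the input
    length. *)
Definition guarded_main :=
  BIf (less (var vT) (var vN)) (aOut ::= Const 0) main.

Definition approx : program :=
  Seq (compile parse_init)
    (Seq parse_loop
      (Seq (Write lim (Const 0) (var vPos)) (compile guarded_main))).

Lemma approxP n l : let w := n :: size l :: enc_hedges l in
  let es := edge_list l in let X := size w in
  exists2 s, env X n (size l) es s &
  exists2 t, exec approx (load w) t (sem guarded_main s) &
    t <= time 0 parse_init + X * (cost parse_guard + time 0 parse_step).+1 +
      4 + time X guarded_main.
Proof.
move=> w es X; set s0 := sem parse_init (load w).
have [t0 E0 T0] := @exec_sem (load w lim 0) parse_init (load w) isT erefl isT.
have S0 : parse_state w (size l) 0 0 2 [::] s0.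
  by split=> //; split.
have d0 : drop 2 w = enc_hedges l ++ [::] by rewrite cats0 /= drop0.
have [s1 [P1 _ [[_ h1 ne1 nv1 pos1] [sT sE]]]] := parse_hedges S0 d0.
have [|t1 E1 T1] := parses_exec P1; first by rewrite /= h1 ne1 nv1.
have E2 := exec_write lim (Const 0) (var vPos) s1.
set s2 := update _ _ _ _ in E2; rewrite [cost _]/= [cost (var _)]/= in E2.
have n1 : s1 vN 0 = n by rewrite (parses_frame P1).
have m1 : s1 vM 0 = size l by rewrite (parses_frame P1).
(* Parsing leaves [vPos] at the length of the whole input, which becomes the bound of all loops. *)
have l2 : s2 lim 0 = X by rewrite /s2 update_same /= pos1.
have [t3 E3 T3] := @exec_sem X guarded_main s2 isT l2 isT.
exists s2; first by split.
exists (t0 + (t1 + (4 + t3))).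
  by apply: exec_seq E0 _; apply: exec_seq E1 _; apply: exec_seq E2 _.
have {}T0 : t0 <= time 0 parse_init by [].
have {}T1 : t1 <= X * (cost parse_guard + time 0 parse_step).+1.
  by apply: leq_trans T1 _; rewrite leq_mul2r ltnW ?orbT.
by move: T0 T1 T3; set a := time 0 _; set b := X * _; set c := time X _; lia.
Qed.

Lemma approx_time : exists K d, forall X,
  time 0 parse_init + X * (cost parse_guard + time 0 parse_step).+1 +
      4 + time X guarded_main <= K * X.+1 ^ d.
Proof.
have [K [d H]] := time_poly guarded_main.
exists (time 0 parse_init + (cost parse_guard + time 0 parse_step).+1 + 4 + K), d.+1.
move=> X; move: (H X).
generalize (time X guarded_main) (time 0 parse_init).
generalize (cost parse_guard + time 0 parse_step).+1 => b c a.
rewrite expnS; have : 0 < X.+1 ^ d by rewrite expn_gt0.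
set e := X.+1 ^ d => e0 ce; rewrite !mulnDl !leq_add //; nia.
Qed.

(** * Hedgegraphs as edge lists *)

Definition hedge_crosses (S : pred nat) (e : seq (seq nat)) : bool :=
  has (fun h => has (fun v => S (head 0 h) != S v) h) e.

Lemma hedge_edges_index j e x : x \in hedge_edges j e -> x.1.1 = j.
Proof. by move=> /flattenP[_ /mapP[h _ ->] /mapP[v _ ->]]. Qed.

Lemma edge_list_index l x : x \in edge_list l -> x.1.1 < size l.
Proof.
elim: l => //= e l IH; rewrite mem_cat => /orP[/hedge_edges_index -> //|/IH].
exact: leqW.
Qed.

Lemma cuts_hedge_edges S j e : cuts (hedge_edges j e) S j = hedge_crosses S e.
Proof.
rewrite /cuts /hedge_edges /hedge_crosses; elim: e => //= h e IH.
rewrite has_cat IH has_map; congr (_ || _).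
by apply: eq_has => v /=; rewrite eqxx.
Qed.

Lemma cut_size_edge_list l S :
  cut_size (size l) (edge_list l) S = count (hedge_crosses S) l.
Proof.
elim: l => [|e l IH]; first by rewrite /cut_size big_ord0.
(* The head of the list carries the largest index, so it accounts for the last term of the sum. *)
rewrite /cut_size big_ord_recr /= addnC; congr (_ + _).
  rewrite /cuts has_cat -/(cuts _ S _) cuts_hedge_edges.
  rewrite (_ : has _ (edge_list l) = false) ?orbF //; apply/negP => /hasP[x].
  by move=> /edge_list_index lt /andP[/eqP e' _]; rewrite e' ltnn in lt.
rewrite -IH; apply: eq_bigr => j _; congr nat_of_bool.
rewrite /cuts has_cat (_ : has _ (hedge_edges _ _) = false) //.
apply/negP => /hasP[x /hedge_edges_index -> /andP[/eqP e' _]].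
by have := ltn_ord j; rewrite -e' ltnn.
Qed.

Lemma edge_list_in n (l : seq (seq (seq nat))) :
  (forall e h v, e \in l -> h \in e -> v \in h -> v < n) ->
  edges_in n (size l) (edge_list l).
Proof.
elim: l => //= e l IH H x; rewrite mem_cat => /orP[|xl]; last first.
  have [|a b c] := IH _ x xl; last by split=> //; apply: leqW.
  by move=> e' h v el; apply: H; rewrite inE el orbT.
move=> /flattenP[_ /mapP[h he ->] /mapP[v vh ->]] /=; split=> //.
  by case: h he vh => // u h he _; apply: (H e (u :: h)); rewrite ?inE ?eqxx.
by apply: (H e h); rewrite ?inE ?eqxx.
Qed.

Lemma size_edge_list l : size (edge_list l) = size (flatten (flatten l)).
Proof.
elim: l => //= e l IH; rewrite flatten_cat !size_cat IH; congr (_ + _).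
by elim: e => //= h e IHe; rewrite !size_cat size_map IHe.
Qed.

(** Pigeonhole: there are fewer vertex occurrences than vertices, so some vertex lies in no
    hyperedge and no hedge cuts its singleton. *)
Lemma isolated_cut n l : 1 < n -> size (edge_list l) < n ->
  exists2 S, nontrivial n S & cut_size (size l) (edge_list l) S = 0.
Proof.
move=> n1; rewrite size_edge_list => ln.
have [/allP sub|/allPn[i]] := boolP (all (mem (flatten (flatten l))) (iota 0 n)).
  by have := uniq_leq_size (iota_uniq 0 n) sub; rewrite size_iota leqNgt ln.
rewrite mem_iota => /= ni iN; exists (pred1 i).
  (* The boolean read as a number is a vertex other than [i]: 1 if [i] is 0, and 0 otherwise. *)
  exists i, (i == 0 : nat); split=> //=; last by case: (i).
  by case: (i == 0) => //; apply: ltnW.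
rewrite cut_size_edge_list; apply/eqP; rewrite -leqn0 leqNgt -has_count.
apply/negP => /hasP[e el /hasP[h he /hasP[v vh]]] /=.
have hN u : u \in h -> (u == i) = false.
  move=> uh; apply: contraNF iN => /eqP <-.
  by apply/flattenP; exists h => //; apply/flattenP; exists e.
rewrite (hN v) // hN //.
by case: (h) vh => // u h' _; rewrite /= inE eqxx.
Qed.

Lemma size_enc_hedges l : size (enc_hedges l) =
  size l + \sum_(e <- l) size e + \sum_(e <- l) \sum_(h <- e) size h.
Proof.
rewrite /enc_hedges; elim: l => [|e l IH]; first by rewrite !big_nil.
rewrite !big_cons /= size_cat IH.
suff -> : size (flatten (map enc_hyperedge e)) = size e + \sum_(h <- e) size h by lia.
elim: e => [|h e IHe]; first by rewrite big_nil.
by rewrite big_cons /= size_cat IHe; lia.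
Qed.

Lemma size_flatten2 (T : Type) (l : seq (seq (seq T))) :
  size (flatten (flatten l)) = \sum_(e <- l) \sum_(h <- e) size h.
Proof.
elim: l => [|e l IH]; first by rewrite big_nil.
rewrite big_cons /= flatten_cat size_cat IH; congr (_ + _).
by elim: e => [|h e IHe]; rewrite ?big_nil // big_cons /= size_cat IHe.
Qed.

Lemma card_set_seq (T : finType) (s : seq T) : uniq s -> #|[set:: s]| = size s.
Proof. by move=> us; rewrite cardsE; apply/card_uniqP. Qed.

Lemma sum_set_seq (T : finType) (s : seq T) F : uniq s ->
  \sum_(x in [set:: s]) F x = \sum_(x <- s) F x.
Proof. by move=> us; rewrite big_uniq //; apply: eq_bigl => x; rewrite inE. Qed.

(** At most one member of a family is empty; every other one contributes at least 1 to the sum. *)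
Lemma card_family (T : finType) (P : {set {set T}}) :
  #|P| <= 1 + \sum_(A in P) #|A|.
Proof.
apply: (@leq_trans (#|P :\ set0| + 1)).
  by rewrite (cardsD1 set0) addnC leq_add2l leq_b1.
rewrite addnC leq_add2l -sum1_card [leqRHS](bigID (fun A => A != set0)) /=.
apply: leq_trans (leq_addr _ _).
rewrite (eq_bigl (fun A => (A \in P) && (A != set0))) => [|A];
  last by rewrite !inE andbC.
by apply: leq_sum => A /andP[_ A0]; rewrite card_gt0.
Qed.

(** * A hedgegraph and its numbered lists *)

Section Link.
Variables (V : finType) (G : hedgegraph V) (nu : V -> 'I_#|V|).
Variable l : seq (seq (seq V)).
Hypotheses (nu_inj : injective nu) (Gl : lists G l).

Definition numbers : seq (seq (seq nat)) :=
  [seq [seq [seq val (nu v) | v <- h] | h <- e] | e <- l].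

Lemma encode_numbers : encode nu l = #|V| :: size numbers :: enc_hedges numbers.
Proof.
rewrite /encode size_map; congr [:: _, _ & flatten _].
rewrite /numbers -map_comp; apply: eq_map => e /=.
rewrite /encode_hedge /enc_hedge size_map; congr (_ :: flatten _).
by rewrite -map_comp; apply: eq_map => h /=; rewrite /enc_hyperedge size_map.
Qed.

Lemma input_size_numbers : input_size G = size (edge_list numbers).
Proof.
have [GE ul ue uh] := Gl.
rewrite size_edge_list size_flatten2 /input_size GE sum_set_seq // !big_map.
rewrite big_seq [RHS]big_seq; apply: eq_bigr => e el.
rewrite sum_set_seq ?ue // !big_map big_seq [RHS]big_seq; apply: eq_bigr => h he.
by rewrite card_set_seq ?size_map // (uh e).
Qed.

(** By [card_family], there are at most 1 more hyperedges than the input size and at most 1 more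
    hedges than hyperedges; the encoding adds 2 header cells. *)
Lemma size_encode : size (encode nu l) <= 5 + 3 * input_size G.
Proof.
have [GE ul ue uh] := Gl.
rewrite encode_numbers /= size_enc_hedges -size_flatten2 -size_edge_list.
rewrite -input_size_numbers.
have HE : \sum_(e <- numbers) size e = \sum_(e in hedges G) #|e|.
  rewrite GE sum_set_seq // !big_map big_seq [RHS]big_seq; apply: eq_bigr => e el.
  by rewrite size_map card_set_seq ?ue // size_map.
have ME : size numbers = #|hedges G| by rewrite GE card_set_seq // !size_map.
have H1 := card_family (hedges G).
have : \sum_(e in hedges G) #|e| <= 1 + input_size G.
  (* As no hyperedge lies in two hedges, the hyperedges of all hedges form one family, to which
     [card_family] applies. *)
  have /eqP -> := hedges_disjoint G.
  apply: leq_trans (card_family _) _.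
  by rewrite /input_size /cover big_trivIset //; apply: hedges_disjoint.
by rewrite HE ME; lia.
Qed.

Lemma hedge_cut_numbers (S : pred nat) :
  #|hedge_cut G [set v | S (nu v)]| =
    cut_size (size numbers) (edge_list numbers) S.
Proof.
have [GE ul ue uh] := Gl.
rewrite cut_size_edge_list /hedge_cut GE.
set T := [set v | S (nu v)].
pose Q (e : {set {set V}}) :=
  [exists h in e, (h :&: T != set0) && (h :\: T != set0)].
have -> : [set e in [set:: map (@set_of_hedge V) l] | Q e] =
    [set:: filter Q (map (@set_of_hedge V) l)].
  by apply/setP => e; rewrite !inE mem_filter andbC.
rewrite card_set_seq ?filter_uniq // size_filter !count_map.
apply: eq_count => e /=; rewrite /hedge_crosses has_map.
(* A hyperedge meets both sides exactly when some vertex is on the other side from its first one. *)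
have QE (h : seq V) : ([set:: h] :&: T != set0) && ([set:: h] :\: T != set0) =
    has (fun v => S (head 0 [seq val (nu v) | v <- h]) != S v)
      [seq val (nu v) | v <- h].
  rewrite has_map; apply/andP/hasP.
    case=> /set0Pn[a]; rewrite !inE => /andP[ah Sa] /set0Pn[b].
    rewrite !inE => /andP[Sb bh].
    case: (boolP (S (head 0 [seq val (nu v) | v <- h]))) => /= Sh.
      by exists b; rewrite //= (negPf Sb).
    by exists a; rewrite //= Sa.
  case: h => [|u h] [v vh] /= Suv; first by rewrite in_nil in vh.
  have uh' : u \in u :: h by rewrite inE eqxx.
  have [Su|Su] := boolP (S (nu u)); rewrite ?Su ?(negPf Su) /= in Suv.
    split; apply/set0Pn; first by exists u; rewrite !inE Su eqxx.
    by exists v; rewrite !inE -in_cons vh andbT; case: (S (nu v)) Suv.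
  split; apply/set0Pn; last by exists u; rewrite !inE (negPf Su) eqxx.
  by exists v; rewrite !inE -in_cons vh; case: (S (nu v)) Suv.
rewrite /Q; apply/exists_inP/hasP.
  by case=> h; rewrite inE => /mapP[h' he ->]; rewrite QE => ?; exists h'.
by case=> h he /= hc; exists [set:: h]; rewrite ?QE // inE map_f.
Qed.

Lemma connectivity_le (T : {set V}) : T != set0 -> T \proper [set: V] ->
  connectivity G <= #|hedge_cut G T|.
Proof.
move=> T0 TV; rewrite /connectivity.
elim: (index_enum _) (mem_index_enum T) => //= A s IH.
rewrite inE big_cons => /orP[/eqP <-|/IH le]; first by rewrite T0 TV geq_minl.
by case: ifP => // _; apply: leq_trans le; apply: geq_minr.
Qed.

Lemma connectivity_attained : 1 < #|V| ->
  exists2 T : {set V}, (T != set0) && (T \proper [set: V]) &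
    #|hedge_cut G T| = connectivity G.
Proof.
move=> V1.
have [x _] : exists2 x : V, x \in V & true.
  by have /card_gt0P[x xV] := ltnW V1; exists x.
pose P (T : {set V}) := (T != set0) && (T \proper [set: V]).
have Px : P [set x].
  rewrite /P -card_gt0 cards1 properEcard subsetT cards1 /=.
  by rewrite cardsT.
(* The induction allows the default value as an outcome; in that case [[set x]] attains it too, its
   cut lying between the connectivity and the number of hedges. *)
pose K m := m = #|hedges G| \/ exists2 T, P T & #|hedge_cut G T| = m.
have [e|[T PT e]] : K (connectivity G); last by exists T.
  rewrite /connectivity; apply: (@big_ind _ K) => [|a b Ka Kb|T PT].
  - by left.
  - by case: (leqP a b).
  - by right; exists T.
exists [set x] => //; apply/eqP; rewrite eqn_leq connectivity_le ?andbT.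
- rewrite e subset_leq_card // /hedge_cut; apply/subsetP => f.
  by rewrite inE => /andP[].
- by case/andP: Px.
- by case/andP: Px.
Qed.

Lemma nu_surj i : i < #|V| -> exists v, val (nu v) = i.
Proof.
move=> iV; have [g _ gK] := inj_card_bij nu_inj (eq_leq (card_ord #|V|)).
by exists (g (Ordinal iV)); rewrite gK.
Qed.

Lemma connectivity_le_cut_size S : nontrivial #|V| S ->
  connectivity G <= cut_size (size numbers) (edge_list numbers) S.
Proof.
move=> [i [j [iV jV Si Sj]]]; rewrite -hedge_cut_numbers.
have [u uE] := nu_surj iV; have [v vE] := nu_surj jV.
apply: connectivity_le; first by apply/set0Pn; exists u; rewrite inE uE.
rewrite properEneq subsetT andbT; apply/eqP => /setP /(_ v).
by rewrite !inE vE (negPf Sj).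
Qed.

Lemma connectivity_cut_size : 1 < #|V| -> exists2 S, nontrivial #|V| S &
  cut_size (size numbers) (edge_list numbers) S = connectivity G.
Proof.
move=> V1; have [T /andP[/set0Pn[u uT] /properP[_ [v _ vT]]] <-] :=
  connectivity_attained V1.
pose S i := [exists v in T, val (nu v) == i].
have SE w : S (nu w) = (w \in T).
  apply/exists_inP/idP => [[w' w'T /eqP/val_inj/nu_inj <-] //|wT].
  by exists w.
exists S; first by exists (nu u), (nu v); rewrite !SE.
rewrite -hedge_cut_numbers; congr #|hedge_cut G _|.
by apply/setP => w; rewrite inE SE.
Qed.

Lemma numbers_lt e h i : e \in numbers -> h \in e -> i \in h -> i < #|V|.
Proof.
move=> /mapP[e' _ ->] /mapP[h' _ ->] /mapP[v _ ->]; exact: ltn_ord.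
Qed.

End Link.

(** * The logarithmic factor and the approximation theorem *)

Section LogBound.
Import GRing.Theory Num.Theory Order.Theory.

(** For positive [L], [(L - 1) * ln 2 <= ln n] and [ln 2 >= 1 / 2] give [2 * (L - 1) <= 4 * ln n];
    the remaining 3 is at most [6 * ln n], as [ln n >= 1 / 2]. *)
Lemma log_bound (R : realType) n L : (1 < n)%N -> (0 < L -> 2 ^ L.-1 < n)%N ->
  ((2 * L).+1%:R <= 10 * ln n%:R :> R)%R.
Proof.
move=> n1 Ln.
have l2 := @ln2_ge R.
have ln2n : (ln 2 <= ln n%:R :> R)%R.
  by rewrite ler_ln ?posrE ?ltr0n // ?ler_nat // ltnW.
case: L Ln => [_|L /(_ isT) /= Ln]; first by lra.
have : (L%:R * ln 2 <= ln n%:R :> R)%R.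
  rewrite mulr_natl -lnXn // ler_ln ?posrE ?exprn_gt0 ?ltr0n //; last exact: ltnW.
  by rewrite -natrX ler_nat ltnW.
have -> : ((2 * L.+1).+1%:R = 2 * L%:R + 3 :> R)%R.
  have -> : ((2 * L.+1).+1 = 2 * L + 3)%N by lia.
  by rewrite natrD natrM.
have : (L%:R * (1 / 2) <= L%:R * ln 2 :> R)%R by rewrite ler_wpM2l.
lra.
Qed.

Lemma log_approx (R : realType) n L out lam :
  (1 < n)%N -> (0 < L -> 2 ^ L.-1 < n)%N -> (out <= (2 * L).+1 * lam)%N ->
  (out%:R <= 10%:R * ln n%:R * lam%:R :> R)%R.
Proof.
move=> n1 LE ub; apply: (@le_trans _ _ ((2 * L).+1 * lam)%:R%R).
  by rewrite ler_nat.
by rewrite natrM ler_wpM2r // log_bound.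
Qed.

End LogBound.

Theorem theorem1p7 :
  exists (p : program) (C c k : nat),
  forall (V : finType) (G : hedgegraph V)
         (nu : V -> 'I_#|V|) (l : seq (seq (seq V))),
    1 < #|V| -> injective nu -> lists G l ->
    exists t out : nat,
      [/\ computes_in p (encode nu l) t out,
          t <= c * (input_size G).+1 ^ k,
          connectivity G <= out
        & forall R : realType,
            (out%:R <= C%:R * ln #|V|%:R * (connectivity G)%:R :> R)%R].
Proof.
have [K [d HK]] := approx_time.
exists approx, 10, (K * 6 ^ d), d => V G nu l V1 nu_inj Gl.
set ll := numbers nu l; set es := edge_list ll; set n := #|V|; set M := size ll.
have [s E [t Et Tt]] := approxP n ll.
have XE : size (n :: M :: enc_hedges ll) = size (encode nu l).
  by rewrite (encode_numbers nu l).
rewrite -encode_numbers -/es -/M in Et E Tt.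
have szX := size_encode nu Gl.
set X := size (encode nu l) in E Tt XE szX.
have es_in : edges_in n M es by apply: edge_list_in => e h v; apply: numbers_lt.
have es_sz : size es = input_size G by rewrite (input_size_numbers nu Gl).
exists t, (sem guarded_main s aOut 0).
(* The constant 6 comes from [X.+1 <= 6 + 3 * input_size G <= 6 * (input_size G).+1]. *)
have time_ok : t <= K * 6 ^ d * (input_size G).+1 ^ d.
  apply: leq_trans Tt _; apply: leq_trans (HK X) _.
  rewrite -mulnA leq_mul2l -expnMn; apply/orP; right.
  by case: (d) => // d'; rewrite leq_exp2r //; lia.
have le_cut := @connectivity_le_cut_size V G nu l nu_inj Gl.
have [S0 S0nt S0E] := connectivity_cut_size nu_inj Gl V1.
set lam := connectivity G in le_cut S0E *.
have lam_le_M : lam <= M by rewrite -S0E cut_size_edge_list count_size.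
have MX : M <= X by rewrite -XE /= size_enc_hedges -/M; lia.
have lam_le_X := leq_trans lam_le_M MX.
suff [le [L LE ub]] : lam <= sem guarded_main s aOut 0 /\
    exists2 L, (0 < L -> 2 ^ L.-1 < n) &
      sem guarded_main s aOut 0 <= (2 * L).+1 * lam.
  split=> //; first by exists (sem guarded_main s).
  by move=> R; apply: log_approx V1 LE ub.
have sT : s vT 0 = size es by case: E.
have sN : s vN 0 = n by case: E.
rewrite /guarded_main sem_less [eval _ _]/= [eval _ (var vN)]/= sT sN.
case: (ltnP (size es) n) => Tn.
  have [S Snt SE] := isolated_cut V1 Tn.
  have lam0 : lam = 0 by apply/eqP; rewrite -leqn0 -SE le_cut.
  by rewrite lam0; split=> //; exists 0.
have TX : size es <= X.
  by rewrite -XE /= size_enc_hedges -size_flatten2 -size_edge_list -/es; lia.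
have nX : n <= X by lia.
have [L [q [nL LE qle qge ->]]] := mainP es_in nX MX TX E.
set g := run _ _ _ _ _ in qle qge *.
have [lam0|lam_gt0] := posnP lam.
  rewrite lam0 in S0E.
  rewrite (run_disconnected es_in X (X * X) S0nt S0E) lam0.
  by split=> //; exists L; rewrite ?muln0.
have X0 : 0 < X by lia.
have M0 : 0 < M := leq_trans lam_gt0 lam_le_M.
have m1 : nroots n (label g) <= 1.
  exact: (nroots_run es_in lam_gt0 le_cut).
(* [X * X] rounds suffice here because both [M] and [lam] are at most [X]. *)
have ub : lam * maxhits g <= X * X * (2 * L).+1.
  apply: (maxhits_upper es_in lam_gt0 le_cut V1 Rdefinitions.R) => //.
  by rewrite leq_mul.
have lb : X * X <= lam * maxhits g.
  exact: (maxhits_lower es_in lam_gt0 le_cut V1 (X * X) S0nt S0E M0 nX).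
(* By [ub], [lam] is itself a coefficient considered by the quotient, hence [lam <= q]. *)
rewrite ltnNge m1 /=; split; first exact: qge.
exists L => //.
have c0 : 0 < maxhits g.
  move: lb; rewrite leqNgt; apply: contraNltn; rewrite leqn0 => /eqP ->.
  by rewrite muln0 muln_gt0 X0.
(* Multiplying by [maxhits g] reduces the upper bound on [q] to [X * X <= lam * maxhits g], that is,
   [lb]. *)
rewrite -(leq_pmul2r c0); apply: leq_trans qle _.
by rewrite [_.+1 * lam]mulnC [lam * _ * _]mulnAC leq_mul2r lb orbT.
Qed.
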